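(* Let $k$ be any algebraically closed field, let $R$ be any regular local ring such that $R$ contains $k$ as a subring, $R/M(R)\cong k$ as $k$-algebras, $R$ is a localization of a finitely generated $k$-algebra and $\dim R\geq1$. Let $P$ be any parameter system of $R$ and $z\in P$ any element. Consider any $\phi\in R$ with $\phi\neq0$, and let $h\in\mathbb Z_0$ be the order of $\phi$, i.e. $\phi\in M(R)^h-M(R)^{h+1}$. Then there exists a mapping $\alpha:P-\{z\}\to k$ such that $\bar P=\{z\}\cup\{x-\alpha(x)z\mid x\in P-\{z\}\}$ is a parameter system of $R$ containing $z$, $\Gamma_+(\bar P,\phi)$ is of $z$-Weierstrass type, the unique $z$-top vertex of $\Gamma_+(\bar P,\phi)$ is $\{hf^{\bar P}_z\}$, and $\mathrm{Inv}(\bar P,z,\phi)\leq h$.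
   Context: $\mathbb Z_0,\mathbb R_0$ are the non-negative integers/reals, $\mathbb Z_+$ the positive integers. $M(R)$ is the maximal ideal, $R^\times$ the units, $R^c$ the completion. A parameter system of a regular local ring $A$ is a finite subset $P\subset M(A)$ with $\sharp P=\dim A$ generating $M(A)$. $\mathrm{Map}(X,Y)$ is the set of maps $X\to Y$; for a finite set $P$ and $x\in P$, $f^P_x\in\mathrm{Map}(P,\mathbb Z_0)$ is the indicator function of $x$, and $\{f^{P\vee}_x\}$ is the dual basis of $\mathrm{Map}(P,\mathbb R)^*$, with pairing $\langle\ ,\ \rangle$. Newton polyhedra: for a parameter system $P$ of $R$, each $\phi\in R\subset R^c$ is uniquely $\phi=\sum_{\Lambda\in\mathrm{Map}(P,\mathbb Z_0)}c(\Lambda)\prod_{x\in P}x^{\Lambda(x)}$ with $c(\Lambda)\in k$; for $\phi\ne0$, $\Gamma_+(P,\phi)$ is the convex hull of $\{\Lambda\mid c(\Lambda)\neq0\}$ plus $\mathrm{Map}(P,\mathbb R_0)$. Vertices are its zero-dimensional faces. For $z\in P$, a vertex is a $z$-top vertex if it maximizes $\langle f^{P\vee}_z,\cdot\rangle$ among all vertices. $\Gamma_+(P,\phi)$ is of $z$-Weierstrass type if there is $a\in\Gamma_+(P,\phi)$ with $\langle f^{P\vee}_x,a\rangle=\min_{\Gamma_+(P,\phi)}\langle f^{P\vee}_x,\cdot\rangle$ for every $x\in P-\{z\}$; it then has a unique $z$-top vertex. Invariant: write $\phi=u\prod_{\omega\in\Omega}\omega^{a(\omega)}$ with $u\in R^\times$,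 $\Omega$ a finite set of irreducible elements of the UFD $R$, $a:\Omega\to\mathbb Z_+$, and let $\Xi=\{\omega\in\Omega\mid\partial\omega/\partial z\in M(R^c)$, and no $x\in P-\{z\}$ divides $\omega\}$ (formal derivative in $R^c=k[[P]]$). A main factor of $(P,z,\phi)$ is any $v\prod_{\omega\in\Xi}\omega^{a(\omega)}$ with $v\in R^\times$. If $\Gamma_+(P,\phi)$ is of $z$-Weierstrass type and $\psi$ is a main factor, then $\Gamma_+(P,\psi)$ is of $z$-Weierstrass type with $z$-top vertex $\{h'f^P_z\}$ for a unique $h'\in\mathbb Z_0$, and $\mathrm{Inv}(P,z,\phi):=h'$ (independent of the choice of $\psi$). *)

(* Defs.v *)
From HB Require Import structures.
From mathcomp Require Import all_boot all_order all_algebra finmap.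
From mathcomp Require Import mathcomp_extra boolp classical_sets reals convex.

Set Implicit Arguments.
Unset Strict Implicit.
Unset Printing Implicit Defensive.

Import Order.TTheory GRing.Theory Num.Theory.
Local Open Scope classical_set_scope.
Local Open Scope fset_scope.
Local Open Scope ring_scope.

Section LocalRings.
Variable R : comUnitRingType.

Definition genideal (S : set R) : set R := [set x |
  exists s : seq (R * R),
    (forall p, p \in s -> S p.2) /\ x = \sum_(p <- s) p.1 * p.2].

Definition ideal_pow (I : {pred R}) (n : nat) : set R :=
  genideal [set x | exists t : n.-tuple R,
    {subset t <= I} /\ x = \prod_(y <- t) y].

(* [idealr_closed] only covers proper ideals; the unit ideal is generated
   by 1. *)
Definition noetherian : Prop := forall I : {pred R}, idealr_closed I ->
  exists s : seq R, forall x, x \in I <-> genideal [set` s] x.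

(* M(R), when R is local *)
Definition maxideal : {pred R} := [predC GRing.unit].

Definition local_ring : Prop := idealr_closed maxideal.

Definition prime_chain (n : nat) (p : 'I_n.+1 -> {pred R}) : Prop :=
  (forall i, idealr_closed (p i) /\ prime_idealr_closed (p i)) /\
  (forall i j : 'I_n.+1, (i < j)%N ->
     {subset p i <= p j} /\ ~ {subset p j <= p i}).

Definition krull_dim (n : nat) : Prop :=
  (exists p : 'I_n.+1 -> {pred R}, prime_chain p) /\
  (forall m (p : 'I_m.+1 -> {pred R}), prime_chain p -> (m <= n)%N).

Definition param_system (P : {fset R}) : Prop :=
  [/\ {subset P <= maxideal}, krull_dim #|` P| &
      forall x, x \in maxideal <-> genideal [set` P] x].

Definition regular_local_ring : Prop :=
  [/\ noetherian, local_ring & exists P : {fset R}, param_system P].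

Definition irreducible_elt (w : R) : Prop :=
  w \isn't a GRing.unit /\
  forall a b, w = a * b -> a \is a GRing.unit \/ b \is a GRing.unit.

End LocalRings.

Arguments maxideal : clear implicits.
Arguments noetherian : clear implicits.
Arguments local_ring : clear implicits.
Arguments krull_dim : clear implicits.
Arguments regular_local_ring : clear implicits.

(* An isomorphism R / M(R) ~ k of k-algebras, presented as the k-algebra map
   R -> k with kernel M(R) that induces it (a k-algebra map to k is onto). *)
Definition residue_field_is (k : fieldType) (R : comUnitAlgType k) : Prop :=
  exists f : {lrmorphism R -> k^o}, forall x, x \in maxideal R <-> f x = 0.

Definition finitely_generated (k : fieldType) (A : comAlgType k) : Prop :=
  exists s : seq A, forall B : {pred A},
    GRing.subalg_closed B -> {subset s <= B} -> forall a, a \in B.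

(* f : A -> R exhibits R as the localization S^-1 A. *)
Definition is_localization (k : fieldType) (A : comAlgType k)
    (R : comUnitAlgType k) (S : {pred A}) (f : {lrmorphism A -> R}) : Prop :=
  [/\ GRing.mulr_closed S,
      (forall s, s \in S -> f s \is a GRing.unit),
      (forall r, exists a s, s \in S /\ r = f a / f s) &
      (forall a, f a = 0 -> exists2 s, s \in S & s * a = 0)].

Definition localization_of_fg (k : fieldType) (R : comUnitAlgType k) : Prop :=
  exists (A : comAlgType k) (S : {pred A}) (f : {lrmorphism A -> R}),
    finitely_generated A /\ is_localization S f.

(* Map(P, Z_0) and Map(P, R), with the indicator functions f^P_x. The dual
   basis form f^{P vee}_x is the evaluation at x. *)
Notation mindex P := {ffun P -> nat}.
Notation rmap K P := {ffun P -> K^o}.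

Definition indic (P : finType) (x : P) : mindex P :=
  [ffun y => nat_of_bool (y == x)].

Definition toreal (K : realType) (P : finType) (L : mindex P) : rmap K P :=
  [ffun x => (L x)%:R].

(* k[[P]], which is R^c once R contains its residue field k; a series is the
   family of its coefficients. *)
Section PowerSeries.
Variables (k : fieldType) (P : finType).

Definition pseries : Type := mindex P -> k.

(* An index L' <= L has all its entries at most |L|. *)
Definition ps_mul (f g : pseries) : pseries := fun L =>
  \sum_(L' : {ffun P -> 'I_(\sum_x L x).+1} | [forall x, (L' x <= L x)%N])
     f [ffun x => nat_of_ord (L' x)] * g [ffun x => (L x - L' x)%N].

Definition ps_one : pseries := fun L => (L == 0)%:R.

Definition ps_max : set pseries :=
  [set f | ~ exists g, ps_mul f g = ps_one].

Definition ps_deriv (z : P) (f : pseries) : pseries :=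
  fun L => f (L + indic z) *+ (L z).+1.

End PowerSeries.

Section Expansion.
Variables (k : fieldType) (R : comUnitAlgType k) (P : {fset R}).

Definition monomial (L : mindex P) : R := \prod_(x : P) fsval x ^+ L x.

(* Convergence in R^c of the series with coefficients c to phi; it is stated
   in R because the trace of M(R^c)^n on R is M(R)^n. *)
Definition is_expansion (phi : R) (c : pseries k P) : Prop :=
  forall n, ideal_pow (maxideal R) n
    (phi - \sum_(L : {ffun P -> 'I_n} | (\sum_x L x < n)%N)
       let L' : mindex P := [ffun x => nat_of_ord (L x)] in
       c L' *: monomial L').

(* When R is local with residue field k and P is a parameter system, exactly
   one c satisfies [is_expansion phi c]. *)
Definition expansion (phi : R) : pseries k P :=
  xget (fun=> 0) [set c | is_expansion phi c].

End Expansion.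

Arguments expansion {k R} P phi.

Section Newton.
Variables (K : realType) (P : finType).

Definition convex_hull (A : set (rmap K P)) : set (rmap K P) :=
  smallest (@convex_set K (rmap K P)) A.

Definition face (S F : set (rmap K P)) : Prop :=
  F !=set0 /\ exists w : {linear rmap K P -> K^o},
    F = [set a | S a /\ forall b, S b -> w a <= w b].

Definition vertex (S : set (rmap K P)) (a : rmap K P) : Prop :=
  face S [set a].

Definition top_vertex (z : P) (S : set (rmap K P)) (a : rmap K P) : Prop :=
  vertex S a /\ forall b, vertex S b -> b z <= a z.

Definition weierstrass_type (z : P) (S : set (rmap K P)) : Prop :=
  exists2 a, S a & forall x : P, x != z -> forall b, S b -> a x <= b x.

End Newton.

Definition newton (K : realType) (k : fieldType) (R : comUnitAlgType k)
    (P : {fset R}) (phi : R) : set (rmap K P) :=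
  [set a + b | a in convex_hull
                 [set toreal K L | L in [set L : mindex P | expansion P phi L != 0]]
             & b in [set b : rmap K P | forall x, 0 <= b x]].

Arguments newton K {k R} P phi.

Section Invariant.
Variables (K : realType) (k : fieldType) (R : comUnitAlgType k).
Variables (P : {fset R}) (z : P).

(* The condition that defines the subset Xi of Omega. *)
Definition in_Xi (w : R) : Prop :=
  ps_max (ps_deriv z (expansion P w)) /\
  forall x : P, x != z -> ~ exists r, w = fsval x * r.

Definition main_factor (phi psi : R) : Prop :=
  exists (u v : R) (Omega : {fset R}) (a : R -> nat),
  [/\ u \is a GRing.unit /\ v \is a GRing.unit,
      (forall w, w \in Omega -> irreducible_elt w /\ (0 < a w)%N),
      phi = u * \prod_(w <- Omega) w ^+ a w &
      psi = v * \prod_(w <- Omega | `[< in_Xi w >]) w ^+ a w].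

(* Inv(P, z, phi) = h', as computed from some main factor. *)
Definition is_Inv (phi : R) (h' : nat) : Prop :=
  exists psi, [/\ main_factor phi psi,
    weierstrass_type z (newton K P psi) &
    [set a | top_vertex z (newton K P psi) a] = [set toreal K (indic z *+ h')]].

End Invariant.

Arguments is_Inv K {k R P} z phi h'.

(* Main.v *)
Require Import Defs.
From HB Require Import structures.
From mathcomp Require Import all_boot all_order all_algebra finmap.
From mathcomp Require Import mathcomp_extra boolp classical_sets reals.
From mathcomp Require Import interval_inference convex zify ring lra.

Set Implicit Arguments.
Unset Strict Implicit.
Unset Printing Implicit Defensive.

(** Write [M] for the maximal ideal of [R] and [d] for its dimension. Modulo
    [M ^ n.+1] an element of [M ^ n] is a homogeneous form [F] of degree [n] in
    the parameters, with coefficients in [k] ([form_ex]). Choose a line through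
    the origin of the tangent space, that is, scalars [alpha x] with
    [alpha z = 1], and let [J] be the ideal generated by the elements
    [x - alpha x * z]. Modulo [J] every parameter [x] becomes [alpha x * z], so
    [F] becomes [F(alpha) * z ^ n] ([line_form]). Hence for [phi] of order [h]
    with leading form [F], a choice of [alpha] with [F(alpha) <> 0] puts the
    monomial [z ^ h] in the expansion of [phi] with respect to the sheared
    parameters [z] and [x - alpha x * z], while every monomial in the expansion
    has degree at least [h]. These two facts alone determine the corner of the
    Newton polyhedron on the [z]-axis: it is minimal in every direction other
    than [z], and it is the only vertex of height at least [h]
    ([polyhedron_weierstrass], [polyhedron_top]).

    For the invariant, let [phi = psi * chi], as is the case when [psi] is a
    main factor. Orders add up, because forms over an infinite field multiply
    without zero divisors ([order_mul]); so if [z ^ g] were missing from the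
    leading form of [psi], [g] its order, then [z ^ h] would be missing from
    that of [phi]. Therefore [psi] satisfies the same two facts as [phi], with
    its own order [g <= h], and [Inv] is equal to [g] ([factor_line],
    [Inv_le_order]).

    All of this rests on one property of regular local rings: [z ^ n] never
    belongs to [J + M ^ n.+1] ([line_pow_notin]). It makes [F] well defined
    ([form_coef0]), and with it the coefficients of expansions. If it failed,
    then [M ^ n] would be contained in [J], an ideal with [d - 1]
    generators, against Krull's height theorem, which is proved here in the
    form [prime_chain_bound]: if [M ^ n] is contained in an ideal generated by
    [m] elements of [M], a chain of primes has length at most [m]. The same
    bound shows that the sheared parameters remain distinct.

    The proof of the bound counts dimensions over [k]. On the one hand the
    dimension of [R / M ^ N] is at most a constant times [N ^ m]
    ([span_mod_powers]). On the other hand, let [p_0 < ... < p_l] be primes and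
    pick [x_i] in [p_(i+1)] but not in [p_i]. Take a relation modulo [M ^ N]
    between monomials in the [x_i] with exponents less than [T], and consider
    its lowest monomial, in the lexicographic order. Modulo [p_0] the power of
    [x_0] that divides the relation can be cancelled, after which [x_0] can be
    set to zero modulo [p_1], and so on; at the end the lowest coefficient lies
    in [M], so it vanishes. Cancelling [x_i] is exact modulo [p_i] but costs a
    bounded power of [M], by the Artin-Rees lemma ([artin_rees_prime]), so the
    argument works as soon as [N] exceeds a constant times [T]
    ([boxsum_indep]). Thus [T ^ l] monomials are independent modulo [M ^ N]
    with [N] proportional to [T], whence [l <= m]. *)

Import Order.TTheory GRing.Theory Num.Theory.
Local Open Scope classical_set_scope.
Local Open Scope ring_scope.

(** * Ideals *)

Section Ideals.
Variable R : comUnitRingType.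
Implicit Types (I J S : set R) (x y r : R).

(** The unit ideal is allowed, so that sums, powers and generated ideals need
    no properness condition. *)
Definition isideal I : Prop :=
  I 0 /\ forall a u v, I u -> I v -> I (a * u + v).

Definition idealD I J : set R := [set x | exists i j, [/\ I i, J j & x = i + j]].

Lemma isideal0 I : isideal I -> I 0.
Proof. by case. Qed.

Lemma isideal_lin I a u v : isideal I -> I u -> I v -> I (a * u + v).
Proof. by move=> [_]; apply. Qed.

Lemma isidealM I a u : isideal I -> I u -> I (a * u).
Proof. by move=> [I0 Il] Iu; rewrite -[_ * _]addr0; apply: Il. Qed.

Lemma isidealMr I a u : isideal I -> I u -> I (u * a).
Proof. by rewrite mulrC; apply: isidealM. Qed.

Lemma isideal_add I u v : isideal I -> I u -> I v -> I (u + v).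
Proof. by move=> [I0 Il] Iu Iv; rewrite -[u]mul1r; apply: Il. Qed.

Lemma isideal_opp I u : isideal I -> I u -> I (- u).
Proof. by move=> iI Iu; rewrite -mulN1r; apply: isidealM. Qed.

Lemma isideal_sub I u v : isideal I -> I u -> I v -> I (u - v).
Proof. by move=> iI Iu Iv; apply: isideal_add => //; apply: isideal_opp. Qed.

Lemma isideal_sum I (T : Type) (s : seq T) (P : pred T) (F : T -> R) :
  isideal I -> (forall i, P i -> I (F i)) -> I (\sum_(i <- s | P i) F i).
Proof.
move=> iI IF; apply: (big_ind (fun x => I x)) => //; first by case: iI.
by move=> *; apply: isideal_add.
Qed.

Lemma isideal_sum_seq I (T : eqType) (s : seq T) (F : T -> R) :
  isideal I -> (forall i, i \in s -> I (F i)) -> I (\sum_(i <- s) F i).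
Proof.
by move=> iI IF; rewrite big_seq; apply: isideal_sum.
Qed.

Lemma genideal_isideal S : isideal (genideal S).
Proof.
split; first by exists [::]; split => //; rewrite big_nil.
move=> a u v [s [Ss ->]] [t [St ->]].
exists ([seq (a * p.1, p.2) | p <- s] ++ t); split.
  by move=> p; rewrite mem_cat => /orP[/mapP[q /Ss ? ->]|/St].
rewrite big_cat big_map /= mulr_sumr; congr (_ + _).
by apply: eq_bigr => p _; rewrite mulrA.
Qed.
Hint Resolve genideal_isideal : core.

Lemma genideal_gen S x : S x -> genideal S x.
Proof.
move=> Sx; exists [:: (1, x)]; split; first by move=> p; rewrite inE => /eqP->.
by rewrite big_seq1 mul1r.
Qed.

Lemma genideal_sub S I : isideal I -> S `<=` I -> genideal S `<=` I.
Proof.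
move=> iI SI _ [s [Ss ->]]; apply: isideal_sum_seq => // p /Ss Sp.
by apply: isidealM => //; apply: SI.
Qed.

Lemma genideal_mul A B I x y : isideal I ->
  (forall a b, A a -> B b -> I (a * b)) -> genideal A x -> genideal B y -> I (x * y).
Proof.
move=> iI IAB [s [As ->]] [t [Bt ->]].
rewrite mulr_suml; apply: isideal_sum_seq => // p /As Ap.
rewrite mulr_sumr; apply: isideal_sum_seq => // q /Bt Bq.
by rewrite mulrACA; apply: isidealM => //; apply: IAB.
Qed.

Lemma idealD_isideal I J : isideal I -> isideal J -> isideal (idealD I J).
Proof.
move=> iI iJ; split.
  by exists 0, 0; rewrite addr0; split=> //; [case: iI|case: iJ].
move=> a _ _ [i [j [Ii Jj ->]]] [i' [j' [Ii' Jj' ->]]].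
exists (a * i + i'), (a * j + j'); split; [by apply iI.2|by apply iJ.2|ring].
Qed.

Lemma idealDl I J : isideal J -> I `<=` idealD I J.
Proof. by move=> [J0 _] x Ix; exists x, 0; rewrite addr0. Qed.

Lemma idealDr I J : isideal I -> J `<=` idealD I J.
Proof. by move=> [I0 _] x Jx; exists 0, x; rewrite add0r. Qed.

Lemma idealD_sub I J H : isideal H -> I `<=` H -> J `<=` H -> idealD I J `<=` H.
Proof.
by move=> iH IH JH _ [i [j [/IH Hi /JH Hj ->]]]; apply: isideal_add.
Qed.

Lemma isideal_prod_congr I (T : Type) (s : seq T) (f g : T -> R) :
  isideal I -> (forall i, I (f i - g i)) -> I (\prod_(i <- s) f i - \prod_(i <- s) g i).
Proof.
move=> iI fg; apply: (big_ind2 (fun a b => I (a - b))) => //.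
  by rewrite subrr; apply: isideal0.
move=> a b c e ab ce; rewrite (_ : _ - _ = (a - b) * c + b * (c - e)); last by ring.
by apply: isideal_add => //; [apply: isidealMr|apply: isidealM].
Qed.

Lemma noetherian_fg I : noetherian R -> isideal I ->
  exists s : seq R, I = genideal [set` s].
Proof.
move=> nR iI; have [I1|nI1] := pselect (I 1).
  exists [:: 1]; apply/seteqP; split=> x _.
    by rewrite -[x]mulr1; apply: isidealM => //; apply: genideal_gen => /=; rewrite inE.
  by rewrite -[x]mulr1; apply: isidealM.
have mI x : x \in [pred x | `[< I x >]] <-> I x by split=> [/asboolP|Ix] //; apply/asboolP.
have [|s Hs] := nR [pred x | `[< I x >]].
  split; [by apply/mI; case: iI|by apply/negP => /mI|].
  by move=> a u v /mI Iu /mI Iv; apply/mI; apply iI.2.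
by exists s; apply/seteqP; split=> x; rewrite -Hs => /mI.
Qed.

Lemma noetherian_acc (I : nat -> set R) : noetherian R -> (forall n, isideal (I n)) ->
  (forall n, I n `<=` I n.+1) -> exists n, forall m, I m `<=` I n.
Proof.
move=> nR iI Iinc.
have Imono m n : (m <= n)%N -> I m `<=` I n.
  move=> /subnK <-; elim: (n - m)%N => [//|j IH] x /IH; exact: Iinc.
have iU : isideal [set x | exists n, I n x].
  split; first by exists 0%N; case: (iI 0%N).
  move=> a u v [n Iu] [m Iv]; exists (maxn n m); apply (iI _).2.
    exact: (Imono _ _ (leq_maxl _ _)).
  exact: (Imono _ _ (leq_maxr _ _)).
have [s Us] := noetherian_fg nR iU.
have [n Hn] : exists n, forall x, x \in s -> I n x.
  have: forall x, x \in s -> exists n, I n x.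
    move=> x xs; suff : [set x | exists n, I n x] x by [].
    by rewrite Us; apply: genideal_gen.
  elim: s {Us} => [|x s IH] H; first by exists 0%N.
  have [n Hn] := IH (fun y ys => H y (mem_behead (s := x :: s) ys)).
  have [m Hm] := H x (mem_head _ _).
  exists (maxn n m) => y; rewrite inE => /predU1P[->|/Hn].
    exact: (Imono _ _ (leq_maxr _ _)).
  exact: (Imono _ _ (leq_maxl _ _)).
exists n => m x Imx.
have : [set x | exists n, I n x] x by exists m.
by rewrite Us; apply: genideal_sub.
Qed.

Section Powers.
Variable I : {pred R}.
Notation "'I^' n" := (ideal_pow I n) (at level 8, n at level 2, format "'I^' n").

Lemma ipow_isideal n : isideal I^n.
Proof. exact: genideal_isideal. Qed.
Hint Resolve ipow_isideal : core.

Lemma ipow0 x : I^0 x.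
Proof.
rewrite -[x]mulr1; apply: isidealM => //.
by apply: genideal_gen; exists [tuple]; split => //; rewrite big_nil.
Qed.

Lemma ipow_mul m n x y : I^m x -> I^n y -> I^(m + n) (x * y).
Proof.
move=> [s [Hs ->]] [t [Ht ->]].
rewrite mulr_suml; apply: isideal_sum_seq => // p /Hs[u [uI ->]].
rewrite mulr_sumr; apply: isideal_sum_seq => // q /Ht[v [vI ->]].
rewrite mulrACA; apply: isidealM => //; apply: genideal_gen.
exists [tuple of u ++ v]; rewrite big_cat; split=> //.
by move=> w; rewrite mem_cat => /orP[/uI|/vI].
Qed.

Lemma ipow1 x : x \in I -> I^1 x.
Proof.
move=> xI; apply: genideal_gen; exists [tuple x]; rewrite big_seq1.
by split=> // y; rewrite inE => /eqP->.
Qed.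

Lemma ipow1_sub : isideal [set` I] -> I^1 `<=` [set` I].
Proof.
move=> iI; apply: genideal_sub => // _ [t [tI ->]] /=.
case/tupleP: t tI => a t; rewrite tuple0 /= => tI.
by rewrite big_seq1; apply: tI; rewrite inE.
Qed.

Lemma ipow_leq m n : (m <= n)%N -> I^n `<=` I^m.
Proof.
move=> /subnKC <- x; apply: genideal_sub => // _ [t [tI ->]].
have -> : \prod_(y <- t) y = (\prod_(y <- take m t) y) * \prod_(y <- drop m t) y.
  by rewrite -big_cat cat_take_drop.
apply: isidealMr => //; apply: genideal_gen.
have Hs : size (take m t) == m by rewrite size_takel // size_tuple leq_addr.
by exists (Tuple Hs); split => // y /mem_take /tI.
Qed.

Lemma ipow_exp n x : x \in I -> I^n (x ^+ n).
Proof.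
move=> xI; elim: n => [|n IH]; first exact: ipow0.
by rewrite exprS -add1n; apply: ipow_mul => //; apply: ipow1.
Qed.

Lemma ipowS_sub n H : isideal H ->
  (forall x y, x \in I -> I^n y -> H (x * y)) -> I^n.+1 `<=` H.
Proof.
move=> iH Hxy; apply: genideal_sub => // _ [t [tI ->]].
case/tupleP: t tI => a t tI; rewrite big_cons; apply: Hxy.
  by apply: tI; rewrite inE eqxx.
apply: genideal_gen; exists t; split=> // y yt; apply: tI.
by rewrite inE yt orbT.
Qed.

Lemma ipow_principal (J : set R) z n : isideal J ->
  (forall x, x \in I -> exists r, J (x - r * z)) ->
  forall x, I^n x -> exists r, J (x - r * z ^+ n).
Proof.
move=> iJ HI; elim: n => [x _|n IH].
  by exists x; rewrite expr0 mulr1 subrr; case: iJ.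
have iH : isideal [set x | exists r, J (x - r * z ^+ n.+1)].
  split; first by exists 0; rewrite mul0r subr0; case: iJ.
  move=> a u v [r Hr] [s Hs]; exists (a * r + s).
  have -> : a * u + v - (a * r + s) * z ^+ n.+1 =
     a * (u - r * z ^+ n.+1) + (v - s * z ^+ n.+1) by ring.
  by apply iJ.2.
apply: ipowS_sub => // x y /HI[r Hr] /IH[s Hs] /=.
exists (r * s).
have -> : x * y - r * s * z ^+ n.+1 =
   y * (x - r * z) + (r * z) * (y - s * z ^+ n) by rewrite exprS; ring.
apply: isideal_add => //; exact: isidealM.
Qed.

End Powers.

End Ideals.

#[global] Hint Resolve genideal_isideal ipow_isideal : core.

(** * The Artin-Rees lemma *)

(** Exponents are lists of naturals here, because both the stabilization of
    families of ideals and the lexicographic order are treated by recursion on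
    the number of variables. *)
Definition exp_add (s t : seq nat) : seq nat := [seq (p.1 + p.2)%N | p <- zip s t].
Definition exp_sub (s t : seq nat) : seq nat := [seq (p.1 - p.2)%N | p <- zip s t].

Lemma size_exp_add s t : size s = size t -> size (exp_add s t) = size s.
Proof. by move=> st; rewrite size_map size_zip st minnn. Qed.

Lemma sumn_exp_add s t : size s = size t ->
  sumn (exp_add s t) = (sumn s + sumn t)%N.
Proof.
elim: s t => [|a s IH] [|b t] //= [st].
by rewrite [LHS]/= -[sumn (map _ _)]/(sumn (exp_add s t)) IH //; lia.
Qed.

Lemma exp_addC s t : exp_add s t = exp_add t s.
Proof.
rewrite /exp_add; elim: s t => [|a s IH] [|b t] //=.
by rewrite addnC IH.
Qed.

Lemma exp_subK s t : all2 leq s t ->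
  size (exp_sub t s) = size s /\ exp_add s (exp_sub t s) = t.
Proof.
elim: s t => [|a s IH] [|b t] //= /andP[ab /IH[Hs Hd]].
rewrite -/(exp_sub t s) Hs; split => //.
by rewrite /exp_add /= -/(exp_sub t s) -/(exp_add s _) Hd subnKC.
Qed.

Lemma leq_exp_refl s : all2 leq s s.
Proof. by elim: s => //= a s ->; rewrite leqnn. Qed.

Definition exp_lt (s t : seq nat) : bool := ((s : seqlexi nat) < (t : seqlexi nat))%O.

Lemma exp_lt_cons a s b t :
  exp_lt (a :: s) (b :: t) = (a < b)%N || ((a == b) && exp_lt s t).
Proof.
rewrite /exp_lt ltxi_cons leEnat; case: ltngtP => //=.
Qed.

Lemma exp_lt_add u s t : size u = size s -> size s = size t -> exp_lt s t ->
  exp_lt (exp_add u s) (exp_add u t).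
Proof.
elim: u s t => [|c u IH] [|a s] [|b t] //= [us] [st].
rewrite exp_lt_cons /exp_add /= -/(exp_add u s) -/(exp_add u t) exp_lt_cons.
rewrite ltn_add2l eqn_add2l => /orP[->//|/andP[-> lst]].
by rewrite IH // orbT.
Qed.

Fixpoint exps (d n : nat) : seq (seq nat) :=
  if d is d'.+1 then
    flatten [seq [seq a :: L | L <- exps d' (n - a)] | a <- iota 0 n.+1]
  else if n == 0%N then [:: [::]] else [::].

Lemma mem_exps d n L : (L \in exps d n) = (size L == d) && (sumn L == n).
Proof.
elim: d n L => [|d IH] n L; first by case: n L => [|n] [|a L].
apply/flattenP/idP => [[_ /mapP[a an ->] /mapP[L' L'e ->]]|].
  move: an L'e; rewrite mem_iota IH /= => an /andP[/eqP-> /eqP->].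
  by rewrite eqxx subnKC ?eqxx //; lia.
case: L => [|a L] // /andP[/eqP[sL] /eqP<-].
exists [seq a :: L | L <- exps d (sumn (a :: L) - a)].
  by apply/mapP; exists a => //; rewrite mem_iota /=; lia.
by apply/mapP; exists L => //; rewrite IH /= sL addKn !eqxx.
Qed.

Section ArtinRees.
Variable R : comUnitRingType.
Hypothesis nR : noetherian R.

(** The combinatorial core of the Hilbert basis theorem: a monotone family of
    ideals indexed by exponents is determined by its members of bounded degree.
    By induction on the number of variables, the bound exists for the unions
    [U] over the first exponent; each of the finitely many members of [U] that
    matter is reached at some stage [a0], and the finitely many slices with
    first exponent below [a0] are covered by induction as well. *)
Lemma monotone_family_bound d (F : seq nat -> set R) :
  (forall L, size L = d -> isideal (F L)) ->
  (forall L L', size L = d -> all2 leq L L' -> F L `<=` F L') ->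
  exists c, forall L, size L = d -> exists L0,
    [/\ size L0 = d, (sumn L0 <= c)%N, all2 leq L0 L & F L `<=` F L0].
Proof.
elim: d F => [|d IH] F iF Fmono.
  by exists 0%N => -[|//] _; exists [::]; split.
have Fle a b L : size L = d -> (a <= b)%N -> F (a :: L) `<=` F (b :: L).
  by move=> sL ab; apply: Fmono => /=; rewrite ?sL // ab leq_exp_refl.
pose U L : set R := [set r | exists a, F (a :: L) r].
have [||c' Hc'] := IH U.
- move=> L sL; split; first by exists 0%N; apply (iF (0%N :: L)); rewrite /= sL.
  move=> r u v [a Fu] [b Fv]; exists (maxn a b); apply iF; first by rewrite /= sL.
    exact: (Fle _ _ _ sL (leq_maxl _ _)).
  exact: (Fle _ _ _ sL (leq_maxr _ _)).
- move=> L L' sL LL' r [a Fr]; exists a; apply: Fmono Fr => /=; rewrite ?sL //.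
  by rewrite leqnn.
have [a0 Ha0] : exists a0, forall L, size L = d -> (sumn L <= c')%N ->
    U L `<=` F (a0 :: L).
  pose E := flatten [seq exps d i | i <- iota 0 c'.+1].
  have [a0 Ha0] : exists a0, forall L, L \in E -> size L = d -> U L `<=` F (a0 :: L).
    elim: E => [|L E [a Ha]]; first by exists 0%N.
    have [sL|nL] := eqVneq (size L) d; last first.
      by exists a => L'; rewrite inE => /predU1P[-> sL|/Ha//]; rewrite sL eqxx in nL.
    have [|n|b Hb] := @noetherian_acc _ (fun a => F (a :: L)) nR.
    - by move=> n; apply: iF; rewrite /= sL.
    - by apply: Fle.
    exists (maxn a b) => L'; rewrite inE => /predU1P[->|L'E] sL'.
      by move=> r [m /Hb]; apply: (Fle _ _ _ sL' (leq_maxr _ _)).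
    by move=> r /(Ha _ L'E sL'); apply: (Fle _ _ _ sL' (leq_maxl _ _)).
  exists a0 => L sL Lc; apply: Ha0 => //; apply/flattenP.
  exists (exps d (sumn L)); last by rewrite mem_exps sL !eqxx.
  by apply/mapP; exists (sumn L) => //; rewrite mem_iota; lia.
have [c'' Hc''] : exists c, forall a, (a < a0)%N -> forall L, size L = d ->
    exists L0, [/\ size L0 = d, (sumn L0 <= c)%N, all2 leq L0 L &
                 F (a :: L) `<=` F (a :: L0)].
  elim: a0 {Ha0} => [|a0 [c Hc]]; first by exists 0%N.
  have [||c1 Hc1] := IH (fun L => F (a0 :: L)).
  - by move=> L sL; apply: iF; rewrite /= sL.
  - by move=> L L' sL LL'; apply: Fmono; rewrite /= ?sL // leqnn.
  exists (maxn c c1) => a; rewrite ltnS leq_eqVlt => /predU1P[->|aa0] L sL.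
    have [L0 [? ? ? ?]] := Hc1 L sL; exists L0; split => //; lia.
  have [L0 [? ? ? ?]] := Hc a aa0 L sL; exists L0; split => //; lia.
exists (maxn (a0 + c') (a0 + c''))%N => -[//|a L] /= [sL].
have [aa0|a0a] := ltnP a a0.
  have [L0 [s0 le0 LL0 FL]] := Hc'' a aa0 L sL.
  by exists (a :: L0) => /=; rewrite s0 leqnn LL0; split=> //; lia.
have [L0 [s0 le0 LL0 FL]] := Hc' L sL.
exists (a0 :: L0) => /=; rewrite s0 a0a LL0; split=> //; first by lia.
by move=> r Fr; apply: Ha0 => //; apply: FL; exists a.
Qed.

Variables (I : {pred R}) (ps : seq R).
Hypothesis iI : isideal [set` I].
Hypothesis Ips : [set` I] = genideal [set` ps].
Let d := size ps.

Definition mon (s : seq R) (L : seq nat) : R := \prod_(p <- zip s L) p.1 ^+ p.2.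

Lemma mon_add L L' : size L = d -> size L' = d ->
  mon ps (exp_add L L') = mon ps L * mon ps L'.
Proof.
rewrite /d /mon; elim: ps L L' => [|x s IH] [|a L] [|b L'] //=.
  by rewrite !big_nil mulr1.
move=> [sL] [sL']; rewrite /exp_add /= -/(exp_add L L') !big_cons IH //= exprD.
by rewrite mulrACA.
Qed.

Lemma mon_ipow L : size L = d -> ideal_pow I (sumn L) (mon ps L).
Proof.
have : forall x, x \in ps -> x \in I.
  by move=> x xp; have : [set` I] x by rewrite Ips; apply: genideal_gen.
rewrite /d /mon; elim: ps L => [|x s IH] [|a L] //= Hs.
  by move=> _; apply: ipow0.
move=> [sL]; rewrite big_cons; apply: ipow_mul.
  by apply: ipow_exp; apply: Hs; rewrite mem_head.
by apply: IH => // y ys; apply: Hs; rewrite inE ys orbT.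
Qed.

Lemma mon_gen x : x \in ps -> exists e, [/\ size e = d, sumn e = 1%N & mon ps e = x].
Proof.
have mon0 s : mon s (nseq (size s) 0%N) = 1.
  rewrite /mon; elim: s => [|y s IH] /=; first by rewrite big_nil.
  by rewrite big_cons IH mulr1.
rewrite /d; elim: ps => [//|y s IH]; rewrite inE => /predU1P[->|/IH[e [se ee me]]].
  exists (1%N :: nseq (size s) 0%N); rewrite /= size_nseq sumn_nseq; split=> //.
  by rewrite /mon /= big_cons /= expr1 -[X in _ * X]/(mon s _) mon0 mulr1.
exists (0%N :: e); rewrite /= se ee; split=> //.
by rewrite /mon /= big_cons /= expr0 mul1r.
Qed.

Lemma ipow_mon N : ideal_pow I N `<=`
  genideal [set mon ps L | L in [set L | size L = d /\ sumn L = N]].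
Proof.
elim: N => [|N IH].
  move=> x _; rewrite -[x]mulr1; apply: isidealM => //; apply: genideal_gen.
  exists (nseq d 0%N); first by rewrite /= size_nseq sumn_nseq mul0n.
  have : ideal_pow I 0 1 by apply: ipow0.
  rewrite /d /mon; elim: ps => [|y s IH1] //= _; first by rewrite big_nil.
  by rewrite big_cons IH1 ?mulr1 //; apply: ipow0.
apply: ipowS_sub => // x y xI /IH.
have : genideal [set` ps] x by rewrite -Ips.
apply: genideal_mul => // p _ pps [L [sL eL] <-].
have [e [se ee <-]] := mon_gen pps.
rewrite -mon_add //; apply: genideal_gen; exists (exp_add e L) => //=.
by rewrite size_exp_add ?se ?sL // sumn_exp_add ?se ?sL // ee eL add1n.
Qed.

Section Lead.
Variable J : set R.
Hypothesis iJ : isideal J.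

(** What may follow the monomial of exponent [L] in a homogeneous expression
    whose lowest monomial is that one. *)
Definition above L : set R := genideal
  [set mon ps L' | L' in [set L' | [/\ size L' = d, sumn L' = sumn L & exp_lt L L']]].

Lemma above_isideal L : isideal (above L).
Proof. exact: genideal_isideal. Qed.
Hint Resolve above_isideal : core.

(** The coefficients of the lowest monomials of the homogeneous expressions
    with value in [J]. *)
Definition lead_ideal L : set R :=
  [set r | exists2 v, above L v & J (r * mon ps L + v)].

Lemma above_mul L A v : size L = d -> size A = d -> above L v ->
  above (exp_add A L) (mon ps A * v).
Proof.
move=> sL sA; apply: (@genideal_sub _ _ [set v | above _ (mon ps A * v)]).
  split=> /=; first by rewrite mulr0; apply: isideal0.
  by move=> a u w Hu Hv; rewrite mulrDr mulrCA; apply: isideal_lin.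
move=> _ [L' [sL' eL' ll] <-] /=; rewrite -mon_add //.
apply: genideal_gen; exists (exp_add A L') => //=.
rewrite size_exp_add ?sA ?sL' // !sumn_exp_add ?sA ?sL ?sL' // eL'; split => //.
by apply: exp_lt_add; rewrite ?sL ?sL'.
Qed.

Lemma lead_isideal L : isideal (lead_ideal L).
Proof.
split.
  exists 0; first by apply: isideal0.
  by rewrite mul0r addr0; exact: isideal0.
move=> a u v [u' Hu Ju] [v' Hv Jv]; exists (a * u' + v').
  by apply: isideal_lin.
rewrite (_ : _ + _ = a * (u * mon ps L + u') + (v * mon ps L + v')); last by ring.
exact: isideal_lin.
Qed.

Lemma lead_mono L L' : size L = d -> all2 leq L L' -> lead_ideal L `<=` lead_ideal L'.
Proof.
move=> sL LL' r [v Hv Jv]; have [sA eA] := exp_subK LL'.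
exists (mon ps (exp_sub L' L) * v).
  have := above_mul sL _ Hv.
  move=> /(_ (exp_sub L' L)); rewrite sA => /(_ sL).
  suff -> : exp_add (exp_sub L' L) L = L' by [].
  by rewrite exp_addC.
rewrite -{1}eA mon_add ?sA // (_ : _ + _ = mon ps (exp_sub L' L) * (r * mon ps L + v)); last by ring.
exact: isidealM.
Qed.

(** The ideal [H] stands for the product of [J] and the power [N - c] of [I].
    Write [g] as a homogeneous expression of degree [N] in the generators of
    [I]. Its lowest coefficient already occurs as the lowest coefficient of an
    expression of degree at most [c] with value in [J]; subtracting the
    product of the latter by a monomial of degree at least [N - c], which lies
    in [H], raises the lowest monomial. There are finitely many monomials of
    degree [N]. *)
Lemma artin_rees : exists c, forall N (H : set R), isideal H ->
  (forall a j, ideal_pow I (N - c) a -> J j -> H (a * j)) ->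
  forall g, ideal_pow I N g -> J g -> H g.
Proof.
have [||c Hc] := @monotone_family_bound d lead_ideal.
- by move=> L _; apply: lead_isideal.
- by move=> L L' sL; apply: lead_mono.
exists c => N H iH HH g gN Jg.
pose E : seq (seqlexi nat) := sort <=%O (undup (exps d N) : seq (seqlexi nat)).
have mE L : (L \in E) = (size L == d) && (sumn L == N).
  by rewrite mem_sort mem_undup; apply: mem_exps.
have sE : pairwise <%O E by rewrite -lt_sorted_pairwise sort_lt_sorted undup_uniq.
pose span (l : seq (seqlexi nat)) : set R := genideal [set mon ps L | L in [set` l]].
have ispan l : isideal (span l) by apply: genideal_isideal.
have : span E g.
  apply: genideal_sub (ipow_mon gN); first exact: ispan.
  move=> _ [L [sL eL] <-].
  by apply: genideal_gen; exists L => //=; rewrite mE sL eL !eqxx.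
(* The induction runs over the final segments of the list of the exponents of
   degree N in increasing order. *)
have : exists l1, l1 ++ E = E by exists [::].
move: {-2}(E) => l; elim: l g gN Jg => [|L l IH] g gN Jg [l1 El] gl.
  have -> : g = 0; last by apply iH.
  by case: gl => s [Hs ->]; rewrite big_seq big1 // => p /Hs [].
have [r [v [vl gE]]] : exists r v, span l v /\ g = r * mon ps L + v.
  suff : idealD [set x | exists r, x = r * mon ps L] (span l) g.
    by case=> _ [v [[r ->] vl ->]]; exists r, v.
  apply: genideal_sub gl.
    apply: idealD_isideal; last exact: ispan.
    split; first by exists 0; rewrite mul0r.
    by move=> a _ _ [b ->] [b' ->]; exists (a * b + b'); ring.
  move=> _ [L' L'l <-]; have {L'l} : L' \in L :: l by []; rewrite in_cons => /predU1P[->|L'l].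
    by exists (mon ps L), 0; rewrite addr0; split=> //; [exists 1; rewrite mul1r|apply: isideal0].
  apply: idealDr; first by split; [exists 0; rewrite mul0r|move=> a _ _ [b ->] [b' ->]; exists (a * b + b'); ring].
  by apply: genideal_gen; exists L'.
have /andP[/eqP sL /eqP eL] : (size L == d) && (sumn L == N).
  by rewrite -mE -El mem_cat mem_head orbT.
have [l1L Ll] : (forall L', L' \in l1 -> exp_lt L' L) /\ (forall L', L' \in l -> exp_lt L L').
  move: sE; rewrite -El pairwise_cat /= => /and3P[/allrelP l1l _ /andP[/allP Ll _]].
  by split=> // L' /l1l; apply; rewrite mem_head.
have aboveE : above L = span l.
  apply/seteqP; split; apply: genideal_sub; try exact: genideal_isideal.
    move=> _ [L' [sL' eL' ll] <-]; apply: genideal_gen; exists L' => //=.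
    have : L' \in l1 ++ L :: l by rewrite El mE sL' eL' eL !eqxx.
    rewrite mem_cat in_cons => /or3P[/l1L L'L|/eqP L'L|//].
      by move: ll; rewrite /exp_lt lt_gtF.
    by move: ll; rewrite L'L /exp_lt ltxx.
  move=> _ [L' L'l <-]; have {L'l} L'l : L' \in l by [].
  apply: genideal_gen; exists L' => //=.
  have : L' \in E by rewrite -El mem_cat in_cons L'l !orbT.
  by rewrite mE eL => /andP[/eqP-> /eqP->]; split=> //; apply: Ll.
have [L0 [s0 c0 L0L]] := Hc L sL; move=> /(_ r); case.
  by exists v; [rewrite aboveE|rewrite -gE].
move=> v0 v0a Jr.
have [sA eA] := exp_subK L0L; set A := exp_sub L L0 in sA eA.
have eA' : sumn A = (N - sumn L0)%N.
  by rewrite -eL -{1}eA sumn_exp_add ?sA ?s0 // addKn.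
have AN : ideal_pow I (N - c) (mon ps A).
  apply: (@ipow_leq _ _ (N - c) (sumn A)); first by rewrite eA' leq_sub2l.
  by apply: mon_ipow; rewrite sA.
set w := mon ps A * (r * mon ps L0 + v0).
have Hw : H w by apply: HH.
have wN : ideal_pow I N w.
  have -> : w = r * mon ps L + mon ps A * v0.
    by rewrite -eA mon_add ?sA // /w; ring.
  apply: isideal_add => //; first by apply: isidealM => //; rewrite -eL; apply: mon_ipow.
  have := above_mul s0 _ v0a; rewrite -eL => /(_ A); rewrite sA exp_addC eA => /(_ s0).
  apply: genideal_sub => // _ [L' [sL' <- _] <-]; exact: mon_ipow.
have gw : g - w = v - mon ps A * v0.
  by rewrite gE -eA mon_add ?sA // /w; ring.
rewrite -[g](subrK w); apply: isideal_add => //; apply: IH.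
- exact: isideal_sub.
- by apply: isideal_sub => //; apply: isidealM.
- by exists (rcons l1 L); rewrite cat_rcons.
rewrite gw; apply: isideal_sub => //.
rewrite -aboveE -eA exp_addC; apply: above_mul => //; by rewrite sA.
Qed.

End Lead.

(** Multiplication by [x] is injective modulo [p]; the Artin-Rees lemma for
    [p + (x)] makes this stable under perturbations in high powers of [I]. *)
Lemma artin_rees_prime (p : set R) x : isideal p ->
  (forall u v, p (u * v) -> p u \/ p v) -> ~ p x ->
  exists c, forall N r, idealD p (ideal_pow I N) (x * r) ->
    idealD p (ideal_pow I (N - c)) r.
Proof.
move=> ip pp px.
have iJ : isideal (idealD p [set y | exists r, y = x * r]).
  apply: idealD_isideal => //; split; first by exists 0; rewrite mulr0.
  by move=> a _ _ [b ->] [b' ->]; exists (a * b + b'); ring.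
have [c Hc] := artin_rees iJ; exists c => N r [q [m [pq mN xr]]].
have [|||s sN pms] := Hc N [set h | exists2 s, ideal_pow I (N - c) s & p (h - x * s)] _ _ m mN.
- split; first by exists 0; [apply: isideal0|rewrite mulr0 subrr; exact: isideal0].
  move=> a u v [s sN us] [t tN vt]; exists (a * s + t); first by apply: isideal_lin.
  rewrite (_ : _ - _ = a * (u - x * s) + (v - x * t)); last by ring.
  exact: isideal_lin.
- move=> a _ aN [q' [_ [pq' [t ->] ->]]] /=; exists (a * t); first exact: isidealMr.
  rewrite (_ : _ - _ = a * q'); last by ring.
  exact: isidealM.
- exists (- q), (x * r); split; [exact: isideal_opp|by exists r|rewrite xr; ring].
have [//|prs] : p x \/ p (r - s).
  apply: pp; rewrite (_ : _ * _ = q + (m - x * s)); last by rewrite mulrBr xr; ring.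
  exact: isideal_add.
by exists (r - s), s; rewrite subrK.
Qed.
End ArtinRees.

(** * The dimension of a Noetherian local ring *)

Fixpoint boxes (T n : nat) : seq (seq nat) :=
  if n is n'.+1 then [seq a :: s | a <- iota 0 T, s <- boxes T n'] else [:: [::]].

Lemma size_boxes T n : size (boxes T n) = (T ^ n)%N.
Proof. by elim: n => //= n IH; rewrite size_allpairs size_iota IH expnS. Qed.

Lemma boxes_uniq T n : uniq (boxes T n).
Proof.
elim: n => //= n IH; apply: allpairs_uniq => //; first exact: iota_uniq.
by move=> [a s] [b t] _ _ /= [-> ->].
Qed.

Section Height.
Variables (k : fieldType) (R : comUnitAlgType k).
Local Notation M := (maxideal R).
Local Notation "'M^' n" := (ideal_pow (maxideal R) n) (at level 8, n at level 2, format "'M^' n").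

Definition is_subspace (W : set R) : Prop :=
  [/\ W 0, forall u v, W u -> W v -> W (u + v) & forall (c : k) u, W u -> W (c *: u)].

Definition kspan (B : seq R) : set R :=
  [set x | exists c : nat -> k, x = \sum_(j < size B) c j *: B`_j].

Lemma isideal_scale (I : set R) (c : k) u : isideal I -> I u -> I (c *: u).
Proof. by move=> iI Iu; rewrite -mulr_algl; apply: isidealM. Qed.

Lemma isideal_subspace (I : set R) : isideal I -> is_subspace I.
Proof.
move=> iI; split; [exact: iI.1|by move=> *; apply: isideal_add|].
by move=> *; apply: isideal_scale.
Qed.

Lemma kspan_subspace B : is_subspace (kspan B).
Proof.
split.
- by exists (fun=> 0); rewrite big1 // => j _; rewrite scale0r.
- move=> _ _ [c ->] [c' ->]; exists (fun j => c j + c' j).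
  by rewrite -big_split; apply: eq_bigr => j _; rewrite scalerDl.
- move=> a _ [c ->]; exists (fun j => a * c j).
  by rewrite scaler_sumr; apply: eq_bigr => j _; rewrite scalerA.
Qed.

Lemma kspan_gen B b : b \in B -> kspan B b.
Proof.
move=> bB; exists (fun j => (j == index b B)%:R).
have iB : (index b B < size B)%N by rewrite index_mem.
rewrite (bigD1 (Ordinal iB)) //= eqxx scale1r nth_index // big1 ?addr0 // => j.
by rewrite -val_eqE /= => /negbTE ->; rewrite scale0r.
Qed.

Lemma subspace_sum (W : set R) (T : eqType) (s : seq T) (F : T -> R) : is_subspace W ->
  (forall i, i \in s -> W (F i)) -> W (\sum_(i <- s) F i).
Proof.
move=> [W0 WD _] H; rewrite big_seq.
by apply: (big_ind (fun x => W x)) => // i /H.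
Qed.

Lemma kspan_sub B W : is_subspace W -> (forall b, b \in B -> W b) -> kspan B `<=` W.
Proof.
move=> cW BW _ [c ->]; apply: subspace_sum => // j _.
by case: cW => _ _; apply; apply: BW; apply: mem_nth.
Qed.

Lemma kspan_mono B B' : {subset B <= B'} -> kspan B `<=` kspan B'.
Proof.
by move=> BB'; apply: kspan_sub; [apply: kspan_subspace|move=> b /BB'/kspan_gen].
Qed.

(** The coordinates modulo [H] form a matrix with more rows than columns, and
    such a matrix has a non-zero row vector in its kernel. *)
Lemma dependent_mod (H : set R) (T : eqType) (s : seq T) (v : T -> R) (B : seq R) :
  is_subspace H -> uniq s -> (size B < size s)%N ->
  (forall r, exists2 w, kspan B w & H (r - w)) ->
  exists u : T -> k, (exists2 i, i \in s & u i != 0) /\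
    H (\sum_(i <- s) u i *: v i).
Proof.
move=> cH us lt spanB.
have [x0 _] : exists x0, x0 \in s.
  by case: s us lt => // x s _ _; exists x; rewrite mem_head.
have [c Hc] : exists c : nat -> nat -> k, forall i,
    H (v (nth x0 s i) - \sum_(j < size B) c i j *: B`_j).
  suff /choice [c Hc] : forall i, exists c : nat -> k,
      H (v (nth x0 s i) - \sum_(j < size B) c j *: B`_j) by exists c.
  by move=> i; have [_ [c ->] Hc] := spanB (v (nth x0 s i)); exists c.
pose A : 'M[k]_(size s, size B) := \matrix_(i, j) c i j.
have /rowV0Pn[y /sub_kermxP yA y0] : kermx A != 0.
  rewrite kermx_eq0 /row_free eqn_leq negb_and -!ltnNge orbC.
  by rewrite (leq_ltn_trans (rank_leq_col A)).
have [i0 yi0] : exists i, y 0 i != 0 by apply/rV0Pn.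
pose u x := if insub (index x s) is Some i then y 0 i else 0.
have uE (i : 'I_(size s)) : u (nth x0 s i) = y 0 i.
  by rewrite /u index_uniq // insubT //= => lts; congr (y 0 _); apply: val_inj.
exists u; split; first by exists (nth x0 s i0); [apply: mem_nth|rewrite uE].
rewrite (big_nth x0) big_mkord.
have -> : \sum_(i < size s) u (nth x0 s i) *: v (nth x0 s i) =
   \sum_(i < size s) y 0 i *: (v (nth x0 s i) - \sum_(j < size B) c i j *: B`_j).
  rewrite (eq_bigr (fun i : 'I_(size s) => y 0 i *: v (nth x0 s i))); last first.
    by move=> i _; rewrite uE.
  under [RHS]eq_bigr do rewrite scalerBr.
  rewrite sumrB [X in _ - X](_ : _ = 0) ?subr0 //.
  under eq_bigr do rewrite scaler_sumr.
  rewrite exchange_big big1 //= => j _.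
  under eq_bigr do rewrite scalerA.
  rewrite -scaler_suml; have /matrixP/(_ 0 j) := yA; rewrite !mxE.
  under eq_bigr do rewrite mxE.
  by move=> ->; rewrite scale0r.
apply: subspace_sum => // i _; case: cH => _ _; apply; exact: Hc.
Qed.

(** If [B] spans [R] modulo [I + (y)], then the products of [B] with
    [1, y, ..., y ^ (t - 1)] span [R] modulo [I + (y ^ t)]: expand the
    coefficient of [y] repeatedly. *)
Lemma span_powers (I : set R) (B : seq R) (y : R) t : isideal I ->
  (forall r, exists2 v, kspan B v & exists s : R, I (r - v - s * y)) ->
  exists B', size B' = (size B * t)%N /\
    forall r, exists2 v, kspan B' v & exists s : R, I (r - v - s * y ^+ t).
Proof.
move=> iI HB; elim: t => [|t [B' [sB' HB']]].
  exists [::]; rewrite muln0; split=> // r; exists 0.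
    by exists (fun=> 0); rewrite big_ord0.
  by exists r; rewrite expr0 mulr1 subr0 subrr; exact: isideal0.
exists (B' ++ [seq b * y ^+ t | b <- B]); split.
  by rewrite size_cat size_map sB' mulnS addnC.
move=> r; have [v vB' [s Is]] := HB' r; have [w wB [s' Is']] := HB s.
have [_ KD _] := kspan_subspace (B' ++ [seq b * y ^+ t | b <- B]).
exists (v + w * y ^+ t).
  apply: KD; first by apply: kspan_mono vB' => b bB; rewrite mem_cat bB.
  apply: (@kspan_mono [seq b * y ^+ t | b <- B]).
    by move=> b bB; rewrite mem_cat bB orbT.
  case: wB => c ->; exists c; rewrite size_map mulr_suml; apply: eq_bigr => j _.
  by rewrite (nth_map 0) // scalerAl.
exists s'; rewrite exprS (_ : _ - _ - _ = (r - v - s * y ^+ t) + y ^+ t * (s - w - s' * y)).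
  by apply: isideal_add => //; apply: isidealM.
ring.
Qed.

(** For [I] the power [M ^ t] this is the bound, polynomial of degree
    [size ys] in [t], on the dimension of [R / M ^ t]: each generator in [ys]
    is removed at the cost of a factor [t]. *)
Lemma span_mod_powers (I : set R) (ys : seq R) t (B : seq R) : isideal I ->
  (forall y, y \in ys -> I (y ^+ t)) ->
  (forall r, exists2 v, kspan B v & idealD I (genideal [set` ys]) (r - v)) ->
  exists2 B', size B' = (size B * t ^ size ys)%N &
    forall r, exists2 v, kspan B' v & I (r - v).
Proof.
move=> iI; elim: ys B => [|y ys IH] B Iy HB.
  exists B; first by rewrite muln1.
  move=> r; have [v vB [i [j [Ii [s [Hs ->]] E]]]] := HB r; exists v => //.
  rewrite E big_seq big1 ?addr0 //.
  by move=> p /Hs.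
have iI1 : isideal (idealD I (genideal [set` ys])) by apply: idealD_isideal.
have [|B1 [sB1 HB1]] := @span_powers _ B y t iI1.
  move=> r; have [v vB [i [j [Ii jg E]]]] := HB r; exists v => //.
  have [s Hs] : exists s, genideal [set` ys] (j - s * y).
    move: jg; apply: (@genideal_sub _ _ [set j | exists s, genideal _ (j - s * y)]).
      split; first by exists 0; rewrite mul0r subr0; apply: isideal0.
      move=> a u w [s Hs] [s' Hs']; exists (a * s + s').
      rewrite (_ : _ - _ = a * (u - s * y) + (w - s' * y)); last by ring.
      by apply: isideal_lin.
    move=> x xys; have {xys} : x \in y :: ys by [].
    rewrite inE => /predU1P[->|xs]; first by exists 1; rewrite mul1r subrr; apply: isideal0.
    by exists 0; rewrite mul0r subr0; apply: genideal_gen.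
  by exists s, i, (j - s * y); split=> //; rewrite E addrA.
have [||B2 sB2 HB2] := IH B1.
- by move=> z zs; apply: Iy; rewrite inE zs orbT.
- move=> r; have [v vB [s Hs]] := HB1 r; exists v => //.
  rewrite -[_ - v](subrK (s * y ^+ t)); apply: isideal_add => //.
  apply: isidealM => //; apply: idealDl => //; apply: Iy; exact: mem_head.
by exists B2 => //; rewrite sB2 sB1 expnS mulnA.
Qed.

Hypotheses (nR : noetherian R) (lR : local_ring R) (kR : residue_field_is R).

Lemma max_isideal : isideal [set` M].
Proof.
case: lR => M0 _ Mc; split; first exact: M0.
by move=> a u v Mu Mv; apply: Mc.
Qed.
Hint Resolve max_isideal : core.

Lemma residue_ex r : exists c : k, r - c%:A \in M.
Proof.
have [f Hf] := kR; exists (f r : k); apply/Hf.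
have fA (c : k) : f c%:A = c by rewrite linearZZ rmorph1 [LHS]mulr1.
apply: (etrans (rmorphB f _ _)); apply: (etrans (congr1 (fun y => f r - y) (fA _))); exact: subrr.
Qed.

Lemma residue_inj (c : k) : c%:A \in M -> c = 0.
Proof. by have [f Hf] := kR; move/Hf; rewrite linearZZ rmorph1 [LHS]mulr1. Qed.

Lemma ideal_in_max (p : set R) : isideal p -> ~ p 1 -> p `<=` [set` M].
Proof.
move=> ip p1 x px; rewrite /= /maxideal inE; apply/negP => ux; apply: p1.
by rewrite -(mulVr ux); apply: isidealM.
Qed.

Lemma span_mod_max n : exists B, forall r, exists2 v, kspan B v & M^n (r - v).
Proof.
have [ps Mps] := noetherian_fg nR max_isideal.
elim: n => [|n [B HB]].
  exists [::] => r; exists 0; last exact: ipow0.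
  by exists (fun=> 0); rewrite big_ord0.
exists (B ++ [seq mon ps L | L <- exps (size ps) n]) => r.
set B' := B ++ _; have cB' := kspan_subspace B'.
have cW : is_subspace [set x | exists2 v, kspan B' v & M^n.+1 (x - v)].
  case: cB' => [K0 KD KZ]; split; first by exists 0 => //; rewrite subr0; apply: isideal0.
    move=> u v [u' Ku Hu] [v' Kv Hv]; exists (u' + v'); first exact: KD.
    by rewrite opprD addrACA; apply: isideal_add.
  move=> c u [u' Ku Hu]; exists (c *: u'); first exact: KZ.
  by rewrite -scalerBr; apply: isideal_scale.
have [v vB rv] := HB r.
have -> : r = v + (r - v) by rewrite addrC subrK.
have [_ WD _] := cW; apply: WD.
  exists v; first by apply: kspan_mono vB => b; rewrite mem_cat => ->.
  by rewrite subrr; apply: isideal0.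
have [s [Hs ->]] := ipow_mon Mps rv.
apply: subspace_sum => // p /Hs [L [sL eL] <-].
have [c Hc] := residue_ex p.1; exists (c *: mon ps L).
  case: cB' => _ _; apply; apply: kspan_gen; rewrite mem_cat; apply/orP; right.
  by apply: map_f; rewrite mem_exps sL eL !eqxx.
rewrite -mulr_algl -mulrBl -add1n; apply: ipow_mul; first exact: ipow1.
by rewrite -eL; apply: mon_ipow.
Qed.

(** A polynomial in [xs] with coefficients in [k] and all exponents below
    [T]. *)
Definition boxsum T (xs : seq R) (u : seq nat -> k) : R :=
  \sum_(s <- boxes T (size xs)) u s *: mon xs s.

Lemma boxsum_cons T x xs u : boxsum T (x :: xs) u =
  \sum_(a < T) x ^+ a * boxsum T xs (fun s => u (nat_of_ord a :: s)).
Proof.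
have iotaE : iota 0 T = index_iota 0 T by rewrite /index_iota subn0.
rewrite /boxsum /= big_allpairs_dep iotaE big_mkord.
apply: eq_bigr => a _; rewrite mulr_sumr; apply: eq_bigr => s _.
by rewrite /mon /= big_cons /= scalerAr.
Qed.

Lemma boxsum0 T xs u : (forall s, s \in boxes T (size xs) -> u s = 0) ->
  boxsum T xs u = 0.
Proof.
by move=> u0; rewrite /boxsum big_seq big1 // => s /u0 ->; rewrite scale0r.
Qed.

(** Induction on the chain of primes. If the coefficients with first exponent
    below [a] vanish, then [x ^ a] can be cancelled modulo [p 0], at the cost of
    [a * c] powers of [M]; the other terms with first exponent above [a] are
    then multiples of [x], hence vanish modulo [p 1], and the induction
    hypothesis applies to the coefficients with first exponent [a]. *)
Lemma boxsum_indep T c (xs : seq R) (p : nat -> set R) :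
  (forall i, (i <= size xs)%N -> isideal (p i) /\ p i `<=` [set` M]) ->
  (forall i, (i < size xs)%N -> p i `<=` p i.+1 /\ p i.+1 xs`_i) ->
  (forall i, (i < size xs)%N -> forall N r, idealD (p i) M^N (xs`_i * r) ->
     idealD (p i) M^(N - c) r) ->
  forall N, (size xs * (T * c) < N)%N -> forall u,
    idealD (p 0%N) M^N (boxsum T xs u) ->
  forall s, s \in boxes T (size xs) -> u s = 0.
Proof.
elim: xs p => [|x xs IH] p Hp Hx Hc N ltN u.
  rewrite /boxsum /= big_seq1 /mon big_nil => Hu s; rewrite inE => /eqP->.
  apply: residue_inj; have [_ pM] := Hp 0%N isT.
  suff : [set` M] (u [::])%:A by [].
  apply: idealD_sub Hu => // y /(ipow_leq (m := 1)) yM.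
  by apply: ipow1_sub => //; apply: yM.
rewrite boxsum_cons => Hu.
have [ip0 _] := Hp 0%N isT; have [ip1 _] := Hp 1%N isT.
have [p01 p1x] := Hx 0%N isT; rewrite /= in p1x.
have strip a N' r : idealD (p 0%N) M^N' (x ^+ a * r) -> idealD (p 0%N) M^(N' - a * c) r.
  elim: a r => [|a IHa] r; first by rewrite expr0 mul1r subn0.
  rewrite exprSr -mulrA => /IHa /(Hc 0%N isT).
  by rewrite -subnDA mulSn addnC.
have main a : (a < T)%N -> forall s, s \in boxes T (size xs) -> u (a :: s) = 0.
  elim/ltn_ind: a => a IHa aT.
  apply: (IH (fun i => p i.+1) _ _ _ (N - a * c)%N).
  - by move=> i; apply: (Hp i.+1).
  - by move=> i; apply: (Hx i.+1).
  - by move=> i; apply: (Hc i.+1).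
  - have : (a * c <= T * c)%N by rewrite leq_mul2r ltnW ?orbT.
    move: ltN; rewrite /= mulSn; lia.
  pose S b := boxsum T xs (fun s => u (b :: s)).
  have E : \sum_(b < T) x ^+ b * S b = x ^+ a * (S a + x * \sum_(a.+1 <= b < T) x ^+ (b - a.+1) * S b).
    rewrite -(big_mkord xpredT (fun b => x ^+ b * S b)) (big_cat_nat _ (n := a)) //=; last exact: ltnW.
    rewrite big_nat big1 ?add0r; last first.
      by move=> b /= ba; rewrite [S b]boxsum0 ?mulr0 // => s; apply: IHa => //; lia.
    rewrite big_ltn // mulrDr; congr (_ + _).
    rewrite mulrA -exprSr mulr_sumr big_nat [RHS]big_nat; apply: eq_bigr => b /andP[ab _].
    by rewrite mulrA -exprD subnKC.
  move: Hu; rewrite E => /strip; set w := \sum_(_ <= _ < _) _ => Hw.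
  rewrite -/(S a) -[S a](addrK (x * w)).
  have ip1M : isideal (idealD (p 1%N) M^(N - a * c)) by apply: idealD_isideal.
  apply: isideal_sub => //.
    by apply: idealD_sub Hw => // y Hy; [apply: idealDl => //; apply: p01|apply: idealDr].
  by apply: idealDl => //; apply: isidealMr.
by move=> s /allpairsP[[a t] /= [aT tB ->]]; apply: main => //; move: aT; rewrite mem_iota.
Qed.

(** Krull's height theorem for the maximal ideal: a chain of length
    [m > size ys] would give [T ^ m] independent elements in the space
    [R / M ^ N], of dimension at most [size B0 * N ^ size ys], with [N] linear
    in [T]. *)
Theorem prime_chain_bound (ys : seq R) n m (p : 'I_m.+1 -> {pred R}) :
  {subset ys <= M} -> M^n `<=` genideal [set` ys] -> prime_chain p ->
  (m <= size ys)%N.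
Proof.
move=> yM Mn [pp pinc]; rewrite leqNgt; apply/negP => lt.
have [ps Mps] := noetherian_fg nR max_isideal.
have ip i : isideal [set` p i].
  by have [[p0 _ pc] _] := pp i; split=> // a u v pu pv; apply: pc.
have pM i : [set` p i] `<=` [set` M].
  by apply: ideal_in_max => //; have [[_ /negP]] := pp i.
pose q (i : nat) : set R := [set` p (inord i)].
have Hx (i : nat) : exists x, (i < m)%N -> q i.+1 x /\ ~ q i x.
  have [im|mi] := ltnP i m; last by exists 0.
  have [|_ nsub] := pinc (inord i) (inord i.+1).
    by rewrite !inordK; lia.
  have /existsNP[x /not_implyP[px npx]] : ~ forall x, x \in p (inord i.+1) -> x \in p (inord i) by [].
  by exists x.
have [x {}Hx] := choice Hx.
have Hc (i : nat) : exists c, (i < m)%N -> forall N r, idealD (q i) M^N (x i * r) ->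
     idealD (q i) M^(N - c) r.
  have [im|mi] := ltnP i m; last by exists 0%N.
  have [|||c Hc] := @artin_rees_prime _ nR M ps Mps (q i) (x i).
  - exact: ip.
  - move=> u v; have [_ pr] := pp (inord i).
    by move=> /(pr u v) /orP[]; [left|right].
  - exact: (Hx i im).2.
  by exists c.
have [cc {}Hc] := choice Hc.
pose c := \max_(i < m) cc i.
pose xs := mkseq x m.
have sxs : size xs = m by rewrite size_mkseq.
have [B0 HB0] := span_mod_max n.
(* N is the least value allowed by boxsum_indep, and it is at most K * T. As T
   exceeds size B0 * K ^ size ys, the dimension bound size B0 * N ^ size ys is
   less than T ^ (size ys).+1. *)
pose K := (m * c + 1)%N.
pose T := (size B0 * K ^ size ys + 1)%N.
pose N := (m * (T * c) + 1)%N.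
have [|||B sB HB] := @span_mod_powers M^N ys N B0.
- exact: ipow_isideal.
- by move=> y /yM yy; apply: ipow_exp.
- move=> r; have [v vB rv] := HB0 r; exists v => //.
  by apply: idealDr => //; apply: Mn.
have ltB : (size B < size (boxes T m))%N.
  rewrite sB size_boxes.
  have NT : (N <= K * T)%N by rewrite /N /K /T; nia.
  apply: (@leq_ltn_trans (size B0 * (K * T) ^ size ys)).
    by rewrite leq_mul2l; apply/orP; right; case: (size ys) => // j; rewrite leq_exp2r.
  rewrite expnMn mulnA; apply: (@leq_trans (T * T ^ size ys)).
    by rewrite ltn_pmul2r ?expn_gt0 /T ?addn1.
  by rewrite -expnS leq_pexp2l // /T addn1.
have [u [[s sbox us0] Hu]] := dependent_mod (mon xs) (isideal_subspace (ipow_isideal _ _)) (boxes_uniq T m) ltB HB.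
move/eqP: us0; apply.
apply: (@boxsum_indep T c xs q _ _ _ N); rewrite ?sxs //.
- by move=> i _; split; [apply: ip|apply: pM].
- move=> i im; rewrite nth_mkseq //; have [qx _] := Hx i im; split=> // y.
  have [|sub _] := pinc (inord i) (inord i.+1); first by rewrite !inordK; lia.
  exact: sub.
- move=> i im j r; rewrite nth_mkseq // => /(Hc i im); apply: idealD_sub.
  + by apply: idealD_isideal; [apply: ip|].
  + by apply: idealDl.
  + move=> y yj; apply: idealDr; first exact: ip.
    apply: ipow_leq yj; rewrite leq_sub2l //.
    exact: (leq_bigmax (Ordinal im)).
- by rewrite /N addn1.
by apply: idealDr; [exact: ip|rewrite /boxsum sxs].
Qed.
End Height.

(** * Multi-indices *)

Lemma digits_inj (B m : nat) (a b : nat -> nat) :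
  (forall i, (a i < B)%N) -> (forall i, (b i < B)%N) ->
  (\sum_(i < m) a i * B ^ i = \sum_(i < m) b i * B ^ i)%N ->
  forall i, (i < m)%N -> a i = b i.
Proof.
elim: m a b => [//|m IH] a b aB bB.
have E (c : nat -> nat) : (\sum_(i < m.+1) c i * B ^ i = c 0%N + (\sum_(i < m) c i.+1 * B ^ i) * B)%N.
  rewrite big_ord_recl expn0 muln1; congr (_ + _)%N; rewrite big_distrl /=.
  by apply: eq_bigr => i _; rewrite /bump /= add1n expnSr mulnA.
rewrite !E => H.
have ab : a 0%N = b 0%N.
  by have := congr1 (modn^~ B) H; rewrite ![(_ 0%N + _)%N]addnC !modnMDl !modn_small.
have B0 : (0 < B)%N by apply: leq_ltn_trans (aB 0%N).
move: H; rewrite ab => /addnI /eqP; rewrite eqn_pmul2r // => /eqP H.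
by case=> [|i] // im; apply: (IH (fun i => a i.+1) (fun i => b i.+1)).
Qed.

Section MultiIndices.
Variable Q : finType.
Implicit Types L : mindex Q.

Definition mdeg L : nat := \sum_x L x.

Definition mindex_of_ord n (L : {ffun Q -> 'I_n}) : mindex Q :=
  [ffun x => nat_of_ord (L x)].

Definition mindices n (p : pred nat) : seq (mindex Q) :=
  [seq mindex_of_ord f | f in [pred f : {ffun Q -> 'I_n} | p (\sum_x f x)%N]].

Lemma mindices_uniq n p : uniq (mindices n p).
Proof.
rewrite map_inj_uniq => [|L L' /ffunP E]; first exact: enum_uniq.
by apply/ffunP => x; apply: val_inj; have := E x; rewrite !ffunE.
Qed.

Lemma mdeg_ge L x : (L x <= mdeg L)%N.
Proof. by rewrite /mdeg (bigD1 x) //= leq_addr. Qed.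

Lemma mem_mindices n (p : pred nat) L : (forall s, p s -> (s < n)%N) -> (L \in mindices n p) = p (mdeg L).
Proof.
move=> pn; apply/mapP/idP => [[L' ]|pL].
  rewrite mem_enum => pL' ->; congr (is_true (p _)): pL'.
  by apply: eq_bigr => x _; rewrite ffunE.
have Ln x : (L x < n)%N by apply: leq_ltn_trans (pn _ pL); apply: mdeg_ge.
exists [ffun x => Ordinal (Ln x)]; last by apply/ffunP => x; rewrite !ffunE.
rewrite mem_enum; congr (is_true (p _)): pL.
by apply: eq_bigr => x _; rewrite ffunE.
Qed.

Lemma sum_mindices (V : nmodType) n (p : pred nat) (F : mindex Q -> V) :
  \sum_(L <- mindices n p) F L =
  \sum_(L : {ffun Q -> 'I_n} | p (\sum_x L x)%N) F (mindex_of_ord L).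
Proof. by rewrite big_map big_enum. Qed.

Definition mindex_deg n := mindices n.+1 (pred1 n).

Lemma mem_mindex_deg n L : (L \in mindex_deg n) = (mdeg L == n).
Proof. by rewrite mem_mindices // => s /eqP ->. Qed.

Lemma sum_mindices_lt (V : nmodType) n (F : mindex Q -> V) :
  \sum_(L : {ffun Q -> 'I_n} | (\sum_x L x < n)%N) F (mindex_of_ord L) =
  \sum_(j < n) \sum_(L <- mindex_deg j) F L.
Proof.
rewrite -(sum_mindices n (fun s => s < n)%N).
elim: n => [|n IH].
  rewrite big_ord0 big_seq big1 // => L.
  by rewrite mem_mindices.
rewrite big_ord_recr -IH /= -big_cat; apply: perm_big; apply: uniq_perm.
- exact: mindices_uniq.
- rewrite cat_uniq !mindices_uniq andbT /=; apply/hasPn => L.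
  by rewrite mem_mindex_deg mem_mindices // => /eqP->; rewrite ltnn.
move=> L; rewrite mem_cat mem_mindex_deg !mem_mindices //.
by rewrite ltnS leq_eqVlt orbC.
Qed.

Lemma mdegD L L' : mdeg (L + L') = (mdeg L + mdeg L')%N.
Proof. by rewrite /mdeg -big_split; apply: eq_bigr => x _; rewrite ffunE. Qed.

Lemma indicE (x y : Q) n : (indic x *+ n) y = if y == x then n else 0%N.
Proof.
elim: n => [|n IH]; first by rewrite mulr0n ffunE if_same.
rewrite mulrSr ffunE IH ffunE; case: eqP => _; [exact: addn1|exact: addn0].
Qed.

Lemma mdeg_indic (x : Q) n : mdeg (indic x *+ n) = n.
Proof.
rewrite /mdeg (bigD1 x) //= indicE eqxx big1 ?addn0 // => y /negbTE yx.
by rewrite indicE yx.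
Qed.

(** Digits in base [B]: every variable but [z] gets its own power of [B] as its
    weight. The weight of [z] can be zero because the degree determines the
    exponent of [z] from the others. *)
Lemma separating_weights (z : Q) (B : nat) : exists w : Q -> nat, w z = 0%N /\
  forall L L', mdeg L = mdeg L' -> (mdeg L < B)%N ->
    (\sum_x w x * L x = \sum_x w x * L' x)%N -> L = L'.
Proof.
exists (fun x => if x == z then 0 else B ^ enum_rank x)%N; rewrite eqxx; split=> // L L' dL LB.
have L'B : (mdeg L' < B)%N by rewrite -dL.
pose a (L : mindex Q) i := if (insub i : option 'I_#|Q|) is Some j then
   (if enum_val j == z then 0 else L (enum_val j))%N else 0%N.
have aE (L0 : mindex Q) : (\sum_x (if x == z then 0 else B ^ enum_rank x) * L0 x =
   \sum_(i < #|Q|) a L0 i * B ^ i)%N.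
  rewrite (reindex _ (onW_bij _ (@enum_val_bij Q))) /=.
  apply: eq_bigr => i _; rewrite /a valK enum_valK.
  by case: ifP => // _; rewrite mulnC.
have aB (L0 : mindex Q) : (mdeg L0 < B)%N -> forall i, (a L0 i < B)%N.
  move=> L0B i; rewrite /a; case: insubP => [j _ _|_]; last by apply: leq_ltn_trans L0B.
  case: ifP => _; first by apply: leq_ltn_trans L0B.
  by apply: leq_ltn_trans L0B; apply: mdeg_ge.
rewrite !aE => /digits_inj H.
have E x : x != z -> L x = L' x.
  move=> /negbTE xz; have := H (aB _ LB) (aB _ L'B) _ (ltn_ord (enum_rank x)).
  by rewrite /a valK enum_rankK xz.
apply/ffunP => x; have [->|/E//] := eqVneq x z.
move: dL; rewrite /mdeg (bigD1 z) //= [in RHS](bigD1 z) //=.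
by rewrite (eq_bigr (fun i => L' i)) => [/addIn|i /E].
Qed.

End MultiIndices.

(** Restrict the forms to the curve [alpha x = t ^ w x] for separating weights
    [w]. Distinct monomials become distinct powers of [t], so two non-zero
    forms become two non-zero polynomials in [t], and their product has a
    non-root. *)
Lemma form_nonvanishing (k : fieldType) (Q : finType) (z : Q) n m (c c' : mindex Q -> k)
    (L0 L0' : mindex Q) :
  (forall p : {poly k}, p != 0 -> exists t, p.[t] != 0) ->
  mdeg L0 = n -> c L0 != 0 -> mdeg L0' = m -> c' L0' != 0 ->
  exists alpha : Q -> k, [/\ alpha z = 1,
    \sum_(L <- mindex_deg Q n) c L * \prod_x alpha x ^+ L x != 0 &
    \sum_(L <- mindex_deg Q m) c' L * \prod_x alpha x ^+ L x != 0].
Proof.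
move=> kinf dL cL dL' cL'.
have [w [wz wsep]] := separating_weights z (maxn n m).+1.
pose pol (e : mindex Q -> k) j : {poly k} :=
  \sum_(L <- mindex_deg Q j) e L *: 'X^(\sum_x w x * L x)%N.
have polN0 e j L : (j <= maxn n m)%N -> mdeg L = j -> e L != 0 -> pol e j != 0.
  move=> jn dLj eL; apply/eqP => /polyP/(_ (\sum_x w x * L x)%N).
  rewrite coef0 coef_sum (bigD1_seq L) ?mindices_uniq //=; last by rewrite mem_mindex_deg dLj.
  rewrite coefZ coefXn eqxx mulr1 big_seq_cond big1 ?addr0 => [/eqP|L1 /andP[]]; first exact/negP.
  rewrite mem_mindex_deg => /eqP dL1 L1L; rewrite coefZ coefXn; case: eqP => [E|_]; last by rewrite mulr0.
  by case/eqP: L1L; apply: wsep; rewrite ?dL1 ?dLj // ltnS.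
have [t] := kinf (pol c n * pol c' m) (mulf_neq0 (polN0 _ _ _ (leq_maxl _ _) dL cL)
   (polN0 _ _ _ (leq_maxr _ _) dL' cL')).
have polE e j : (pol e j).[t] = \sum_(L <- mindex_deg Q j) e L * \prod_x (t ^+ w x) ^+ L x.
  rewrite horner_sum; apply: eq_bigr => L _; rewrite hornerZ hornerXn; congr (_ * _).
  by rewrite expr_sum; apply: eq_bigr => x _; rewrite exprM.
rewrite hornerM mulf_eq0 negb_or !polE => /andP[pc pc'].
by exists (fun x => t ^+ w x); split=> //; rewrite wz.
Qed.

(** * Leading forms with respect to a parameter system *)

Section Forms.
Variables (k : fieldType) (R : comUnitAlgType k).
Local Notation M := (maxideal R).
Local Notation "'M^' n" := (ideal_pow (maxideal R) n) (at level 8, n at level 2, format "'M^' n").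
Hypothesis kinf : forall p : {poly k}, p != 0 -> exists t, p.[t] != 0.
Hypotheses (nR : noetherian R) (lR : local_ring R) (kR : residue_field_is R).
Variable Q : {fset R}.
Hypothesis parQ : param_system Q.
Implicit Types (L : mindex Q) (c : mindex Q -> k) (alpha : Q -> k).

Let Mi : isideal [set` M] := max_isideal lR.

Definition homform c n : R := \sum_(L <- mindex_deg Q n) c L *: monomial L.

Definition form_eval c n alpha : k :=
  \sum_(L <- mindex_deg Q n) c L * \prod_x alpha x ^+ L x.

Lemma monomialD L L' : monomial (L + L') = monomial L * monomial L'.
Proof.
by rewrite /monomial -big_split; apply: eq_bigr => x _; rewrite ffunE exprD.
Qed.

Lemma monomial_indic (x : Q) n : monomial (indic x *+ n) = fsval x ^+ n.
Proof.
rewrite /monomial (bigD1 x) //= indicE eqxx big1 ?mulr1 // => y /negbTE yx.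
by rewrite indicE yx.
Qed.

Lemma param_mem (x : Q) : fsval x \in M.
Proof. by case: parQ => QM _ _; apply: QM; apply: fsvalP. Qed.

Lemma monomial_pow L : M^(mdeg L) (monomial L).
Proof.
rewrite /monomial /mdeg; apply: (big_ind2 (fun (a : R) n => M^n a)).
- exact: ipow0.
- by move=> *; apply: ipow_mul.
- by move=> x _; apply: ipow_exp; apply: param_mem.
Qed.

Lemma pow_monomial n : M^n `<=` genideal [set @monomial k R Q L | L in [set L | mdeg L = n]].
Proof.
elim: n => [|n IH].
  move=> x _; rewrite -[x]mulr1; apply: isidealM => //; apply: genideal_gen.
  exists 0; first by rewrite /= /mdeg big1 // => y _; rewrite ffunE.
  by rewrite /monomial big1 // => y _; rewrite ffunE.
apply: ipowS_sub => // x y xM /IH; have [_ _ MQ] := parQ; move/MQ: xM.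
apply: genideal_mul => // a _ xQ [L dL <-].
apply: genideal_gen; rewrite /= in dL.
exists (indic [` xQ]%fset *+ 1 + L); first by rewrite /= mdegD mdeg_indic dL.
by rewrite monomialD monomial_indic.
Qed.

Lemma formD c c' n : homform c n + homform c' n = homform (fun L => c L + c' L) n.
Proof. by rewrite /homform -big_split; apply: eq_bigr => L _; rewrite scalerDl. Qed.

Lemma formZ a c n : a *: homform c n = homform (fun L => a * c L) n.
Proof. by rewrite /homform scaler_sumr; apply: eq_bigr => L _; rewrite scalerA. Qed.

Lemma form0 n : homform (fun=> 0) n = 0.
Proof. by rewrite /homform big1 // => L _; rewrite scale0r. Qed.

Lemma form_ex n x : M^n x -> exists c, M^n.+1 (x - homform c n).
Proof.
pose W : set R := [set x | exists c, M^n.+1 (x - homform c n)].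
have cW : is_subspace W.
  split; first by exists (fun=> 0); rewrite form0 subrr; apply: isideal0.
  - move=> u v [c Hu] [c' Hv]; exists (fun L => c L + c' L).
    by rewrite -formD opprD addrACA; apply: isideal_add.
  - move=> a u [c Hu]; exists (fun L => a * c L); rewrite -formZ -scalerBr.
    exact: isideal_scale.
move=> /pow_monomial [s [Hs ->]]; apply: (subspace_sum cW) => p /Hs [L dL <-].
have [a Ha] := residue_ex kR p.1; exists (fun L' => a * (L' == L)%:R).
have -> : homform (fun L' => a * (L' == L)%:R) n = a *: monomial L.
  rewrite /homform (bigD1_seq L) ?mindices_uniq //=; last by rewrite mem_mindex_deg dL.
  by rewrite eqxx mulr1 big1 ?addr0 // => L' /negbTE ->; rewrite mulr0 scale0r.
rewrite -mulr_algl -mulrBl -add1n; apply: ipow_mul; first exact: ipow1.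
by rewrite -dL; apply: monomial_pow.
Qed.

Variable z : Q.

(** The ideal of the line on which every parameter [x] is equal to
    [alpha x * z]. The parameter [z] itself is left out, which makes the number
    of generators one less than the dimension. *)
Definition line_gens alpha : seq R :=
  [seq fsval x - alpha x *: fsval z | x <- enum (predC1 z)].

Definition line alpha : set R := genideal [set` line_gens alpha].

Section Line.
Variable alpha : Q -> k.
Hypothesis alphaz : alpha z = 1.
Notation J := (line alpha).

Lemma line_isideal : isideal J. Proof. exact: genideal_isideal. Qed.
Hint Resolve line_isideal : core.

Lemma line_mem x : J (fsval x - alpha x *: fsval z).
Proof.
have [->|xz] := eqVneq x z; first by rewrite alphaz scale1r subrr; apply: isideal0.
by apply: genideal_gen; apply: map_f; rewrite mem_enum.
Qed.

Lemma line_monomial L : J (monomial L - (\prod_x alpha x ^+ L x) *: fsval z ^+ mdeg L).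
Proof.
have -> : (\prod_x alpha x ^+ L x) *: fsval z ^+ mdeg L =
   \prod_x (alpha x *: fsval z) ^+ L x.
  rewrite /mdeg expr_sum -scaler_prod; apply: eq_bigr => x _; by rewrite exprZn.
apply: isideal_prod_congr => // x; rewrite subrXX.
by apply: isidealMr => //; apply: line_mem.
Qed.

Lemma line_form c n : J (homform c n - form_eval c n alpha *: fsval z ^+ n).
Proof.
rewrite /homform /form_eval scaler_suml -sumrB; apply: isideal_sum_seq => // L.
rewrite mem_mindex_deg => /eqP dL; rewrite -scalerA -scalerBr -dL.
by apply: isideal_scale => //; apply: line_monomial.
Qed.

Lemma line_max x : x \in M -> exists r, J (x - r * fsval z).
Proof.
have [_ _ MQ] := parQ => /MQ.
have iH : isideal [set x | exists r, J (x - r * fsval z)].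
  split; first by exists 0; rewrite mul0r subr0; apply: isideal0.
  move=> a u v [r Hr] [s Hs]; exists (a * r + s).
  rewrite (_ : _ - _ = a * (u - r * fsval z) + (v - s * fsval z)); last by ring.
  exact: isideal_lin.
apply: (genideal_sub iH) => y yQ; exists (alpha [` yQ]%fset)%:A.
by rewrite mulr_algl; apply: (line_mem [` yQ]%fset).
Qed.

(** If [z ^ n] belonged to [J + M ^ n.+1], it would belong to [J] by Nakayama's
    lemma, as [M ^ n.+1] is contained in [J + (z ^ n.+1)]. Then [M ^ n] would be
    contained in [J], which has fewer generators than the dimension of [R]. *)
Lemma line_pow_notin n : ~ idealD J M^n.+1 (fsval z ^+ n).
Proof.
move=> [j [m [Jj mM E]]].
have [r Jr] := ipow_principal line_isideal line_max mM.
have Jz : J (fsval z ^+ n).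
  have u1 : 1 - r * fsval z \is a GRing.unit.
    apply: contraT => nu; have [_ M1 _] := lR; case/negP: M1.
    have -> : 1 = (1 - r * fsval z) + r * fsval z by rewrite subrK.
    suff : [set` M] ((1 - r * fsval z) + r * fsval z) by [].
    by apply: (isideal_add Mi nu); apply: (isidealM _ Mi); apply: param_mem.
  have Eu : fsval z ^+ n * (1 - r * fsval z) = j + (m - r * fsval z ^+ n.+1).
    by rewrite exprS mulrBr mulr1 {1}E; ring.
  rewrite -[_ ^+ n](mulrK u1); apply: isidealMr; first exact: line_isideal.
  by rewrite Eu; apply: isideal_add.
have Mn : M^n `<=` J.
  move=> x /(ipow_principal line_isideal line_max)[s Js].
  by rewrite -(subrK (s * fsval z ^+ n) x); apply: isideal_add => //; apply: isidealM.
have [_ [[p pc] _] _] := parQ.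
have sub : {subset line_gens alpha <= M}.
  move=> _ /mapP[x _ ->]; suff : [set` M] (fsval x - alpha x *: fsval z) by [].
  by apply: isideal_sub => //; [|apply: isideal_scale => //]; apply: param_mem.
have := prime_chain_bound nR lR kR sub Mn pc.
have : (0 < #|{: Q}|)%N by apply/card_gt0P; exists z.
rewrite size_map -cardE cardC1 -cardfE; case: #|` Q| => // q _.
by rewrite ltnn.
Qed.

Lemma line_scale_notin n a : a != 0 -> ~ idealD J M^n.+1 (a *: fsval z ^+ n).
Proof.
move=> a0 H; apply: (@line_pow_notin n).
rewrite -[_ ^+ n](scale1r) -(mulVf a0) -scalerA; apply: isideal_scale => //.
exact: idealD_isideal.
Qed.

End Line.

(** Quasi-regularity of parameter systems: on a line where the form does not
    vanish, its value is a non-zero multiple of [z ^ n]. *)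
Lemma form_coef0 c n : M^n.+1 (homform c n) -> forall L, mdeg L = n -> c L = 0.
Proof.
move=> Mc L dL; apply/eqP; apply: contraT => cL.
have [alpha [az ev _]] := form_nonvanishing z kinf dL cL dL cL.
case: (line_scale_notin az (n := n) ev); rewrite -/(form_eval c n alpha).
rewrite -(subrK (homform c n) (_ *: _)).
exists (form_eval c n alpha *: fsval z ^+ n - homform c n), (homform c n); split=> //.
by rewrite -opprB; apply: isideal_opp; [apply: line_isideal|apply: line_form].
Qed.

Lemma form_neq0 c n x : M^n.+1 (x - homform c n) -> ~ M^n.+1 x ->
  exists2 L, mdeg L = n & c L != 0.
Proof.
move=> xc xM; apply: contrapT => H; apply: xM.
suff -> : x = x - homform c n by [].
rewrite /homform big_seq big1 ?subr0 // => L; rewrite mem_mindex_deg => /eqP dL.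
suff -> : c L = 0 by rewrite scale0r.
by apply/eqP; apply: contraT => cL; case: H; exists L.
Qed.

Lemma order_ex N x : ~ M^N x -> exists2 g, (g < N)%N & M^g x /\ ~ M^g.+1 x.
Proof.
elim: N => [[]|N IH H]; first exact: ipow0.
have [xN|/IH[g gN Hg]] := pselect (M^N x); first by exists N.
by exists g => //; apply: leq_trans gN _.
Qed.

Lemma line_cong c n x alpha : alpha z = 1 -> M^n.+1 (x - homform c n) ->
  idealD (line alpha) M^n.+1 (x - form_eval c n alpha *: fsval z ^+ n).
Proof.
move=> az Hx; exists (homform c n - form_eval c n alpha *: fsval z ^+ n), (x - homform c n).
by split=> //; [apply: line_form|ring].
Qed.

(** The condition on the line says that it is not a zero of the leading form
    of [x]. *)
Lemma generic_line x n : M^n x -> ~ M^n.+1 x ->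
  exists2 alpha, alpha z = 1 & ~ idealD (line alpha) M^n.+1 x.
Proof.
move=> xn xn1; have [c Hc] := form_ex xn; have [L dL cL] := form_neq0 Hc xn1.
have [alpha [az ev _]] := form_nonvanishing z kinf dL cL dL cL.
exists alpha => // Hx; apply: (line_scale_notin az (n := n) ev).
have iJM : isideal (idealD (line alpha) M^n.+1) by apply: idealD_isideal => //; apply: line_isideal.
rewrite -[X in idealD _ _ X](subKr x); apply: isideal_sub => //.
exact: line_cong.
Qed.

(** On a line where neither leading form vanishes, the product is congruent to
    a non-zero multiple of [z ^ (n + m)]. *)
Lemma order_mul x y n m : M^n x -> ~ M^n.+1 x -> M^m y -> ~ M^m.+1 y ->
  ~ M^(n + m).+1 (x * y).
Proof.
move=> xn xn1 ym ym1 xy.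
have [c Hc] := form_ex xn; have [L dL cL] := form_neq0 Hc xn1.
have [c' Hc'] := form_ex ym; have [L' dL' cL'] := form_neq0 Hc' ym1.
have [alpha [az ev ev']] := form_nonvanishing z kinf dL cL dL' cL'.
have iJ := line_isideal alpha.
apply: (line_scale_notin az (n := n + m) (mulf_neq0 ev ev')).
rewrite -/(form_eval c n alpha) -/(form_eval c' m alpha).
set a := form_eval _ _ _; set a' := form_eval _ _ _.
have [j [u [Jj uM E]]] := line_cong az Hc; have [j' [u' [Jj' uM' E']]] := line_cong az Hc'.
rewrite -/a -/a' in E E'.
have {}E : x = a *: fsval z ^+ n + (j + u) by rewrite -E addrC subrK.
have {}E' : y = a' *: fsval z ^+ m + (j' + u') by rewrite -E' addrC subrK.
set zn := a *: _ in E; set zm := a' *: _ in E'.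
have znM : M^n zn by apply: isideal_scale => //; apply: ipow_exp; apply: param_mem.
have zmM : M^m zm by apply: isideal_scale => //; apply: ipow_exp; apply: param_mem.
have -> : (a * a') *: fsval z ^+ (n + m) = zn * zm.
  by rewrite /zn /zm -scalerAl -scalerAr scalerA exprD.
have -> : zn * zm = - (j * y + j' * (zn + u)) + (x * y - (zn * u' + u * (zm + u'))).
  by rewrite E E'; ring.
exists (- (j * y + j' * (zn + u))), (x * y - (zn * u' + u * (zm + u'))); split=> //.
  by apply: isideal_opp => //; apply: isideal_add => //; apply: isidealMr.
apply: isideal_sub => //; apply: isideal_add => //.
  by rewrite -addnS; apply: ipow_mul.
rewrite -addSn; apply: ipow_mul => //; apply: isideal_add => //.
exact: ipow_leq uM'.
Qed.

(** A line that is not a zero of the leading form of a product is not a zero of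
    the leading form of a factor. The additivity of orders is what makes the
    leading form of the product the product of the leading forms. *)
Lemma factor_line alpha h x y : alpha z = 1 -> M^h (x * y) ->
  ~ idealD (line alpha) M^h.+1 (x * y) ->
  exists2 g, (g <= h)%N & M^g x /\ ~ idealD (line alpha) M^g.+1 x.
Proof.
move=> az xyh xyJ; have iJ := line_isideal alpha.
have xyM : ~ M^h.+1 (x * y) by move=> H; apply: xyJ; apply: idealDr.
have [|g gh [xg xg1]] := @order_ex h.+1 x; first by move=> H; apply: xyM; apply: isidealMr.
have [|e eh [ye ye1]] := @order_ex h.+1 y; first by move=> H; apply: xyM; apply: isidealM.
exists g => //; split=> // - [j [m [Jj mM E]]].
have hge : (h <= g + e)%N.
  rewrite leqNgt; apply/negP => lt; apply: (order_mul xg xg1 ye ye1).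
  exact: ipow_leq xyh.
apply: xyJ; rewrite E mulrDl; exists (j * y), (m * y); split=> //; first exact: isidealMr.
have : M^(g.+1 + e) (m * y) by apply: ipow_mul.
by apply: ipow_leq; rewrite addSn ltnS.
Qed.

End Forms.

(** * Power series expansions *)

Section Expansions.
Variables (k : fieldType) (R : comUnitAlgType k).
Local Notation M := (maxideal R).
Local Notation "'M^' n" := (ideal_pow (maxideal R) n) (at level 8, n at level 2, format "'M^' n").
Hypothesis kinf : forall p : {poly k}, p != 0 -> exists t, p.[t] != 0.
Hypotheses (nR : noetherian R) (lR : local_ring R) (kR : residue_field_is R).
Variable Q : {fset R}.
Hypothesis parQ : param_system Q.
Variable z : Q.
Implicit Types (L : mindex Q) (c : mindex Q -> k) (x : R).

Lemma is_expansionE x c :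
  is_expansion x c <-> forall n, M^n (x - \sum_(j < n) homform c j).
Proof.
by split=> H n; have := H n; rewrite -(sum_mindices_lt n (fun L => c L *: monomial L)).
Qed.

(** Subtract leading forms repeatedly: [r n] is what remains after the forms of
    degree less than [n], and [cs] chooses the next form. *)
Lemma expansion_ex x : exists c : pseries k Q, is_expansion x c.
Proof.
have step (p : nat * R) : exists c, M^p.1 p.2 -> M^p.1.+1 (p.2 - homform c p.1).
  have [/(form_ex kR parQ)[c Hc]|nM] := pselect (M^p.1 p.2); first by exists c.
  by exists (fun=> 0).
have [cs {}step] := choice step.
pose r := fix r n := if n is n'.+1 then r n' - homform (cs (n', r n')) n' else x.
pose c L := cs (mdeg L, r (mdeg L)) L.
have cE n : homform c n = homform (cs (n, r n)) n.
  rewrite /homform big_seq [RHS]big_seq; apply: eq_bigr => L.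
  by rewrite mem_mindex_deg /c => /eqP ->.
have rE n : r n = x - \sum_(j < n) homform c j.
  elim: n => [|n IH]; first by rewrite big_ord0 subr0.
  by rewrite big_ord_recr /= opprD addrA -IH cE.
exists c; apply/is_expansionE => n; rewrite -rE.
elim: n => [|n IH]; first exact: ipow0.
exact: (step (n, r n)).
Qed.

Lemma expansionP x : is_expansion x (expansion Q x).
Proof. exact: xgetPex (expansion_ex x). Qed.

Lemma expansion_coef0 x g L : M^g x -> (mdeg L < g)%N -> expansion Q x L = 0.
Proof.
move=> xg; have /is_expansionE Hc := expansionP x.
set c := expansion Q x in Hc *.
have [n En] : exists n, mdeg L = n by exists (mdeg L).
rewrite En; elim/ltn_ind: n L En => n IH L En ng.
apply: (form_coef0 kinf nR lR kR parQ z _ En).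
have := Hc n.+1; rewrite big_ord_recr /= big1 ?add0r => [xc|j _]; last first.
  rewrite /homform big_seq big1 // => L'; rewrite mem_mindex_deg => /eqP dL'.
  by rewrite (IH j) ?scale0r //; apply: ltn_trans ng.
rewrite -(subKr x (homform c n)); apply: isideal_sub => //; exact: ipow_leq xg.
Qed.

(** The line on which all the parameters except [z] vanish. *)
Definition axis : Q -> k := fun y : Q => (y == z)%:R.

(** Every monomial of degree [g] other than [z ^ g] vanishes on the
    [z]-axis. *)
Lemma expansion_axis x g : M^g x -> ~ idealD (line z axis) M^g.+1 x ->
  expansion Q x (indic z *+ g) != 0.
Proof.
move=> xg xJ; apply/eqP => c0; apply: xJ.
have /is_expansionE Hc := expansionP x; have := Hc g.+1.
have iJ : isideal (line z axis) := line_isideal _ _.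
rewrite big_ord_recr /= big1 ?add0r => [xc|j _]; last first.
  rewrite /homform big_seq big1 // => L; rewrite mem_mindex_deg => /eqP dL.
  by rewrite (expansion_coef0 xg) ?scale0r // dL.
exists (homform (expansion Q x) g), (x - homform (expansion Q x) g); split=> //; last by ring.
apply: isideal_sum_seq => // L; rewrite mem_mindex_deg => /eqP dL.
have [->|Lz] := eqVneq L (indic z *+ g); first by rewrite c0 scale0r; apply: isideal0.
apply: isideal_scale => //.
have [y yz Ly] : exists2 y, y != z & (0 < L y)%N.
  apply: contrapT => H; case/eqP: Lz; apply/ffunP => y; rewrite indicE.
  have L0 w : w != z -> L w = 0%N.
    by move=> wz; apply/eqP; rewrite -leqn0 leqNgt; apply/negP => Lw; apply: H; exists w.
  case: eqVneq => [->|/L0//]; rewrite -dL /mdeg (bigD1 z) //= big1 ?addn0 //.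
rewrite /monomial (bigD1 y) //=; apply: isidealMr => //.
rewrite -(prednK Ly) exprS; apply: isidealMr => //.
have := @line_mem _ _ _ z axis _ y; rewrite /axis (negbTE yz) scale0r subr0; apply.
by rewrite eqxx.
Qed.

End Expansions.

(** * Newton polyhedra *)

Section Polyhedra.
Variables (K : realType) (P : finType) (z : P) (g : nat).
Implicit Types (a b : rmap K P).

(** A linear form that exposes the corner on the [z]-axis as a vertex: the
    degree bounds the first sum from below by [g], and the second sum is
    non-negative and vanishes only on the axis. *)
Definition tilt a : K^o := \sum_x a x + \sum_(x | x != z) a x.

Lemma tilt_linear : linear tilt.
Proof.
move=> t a b; rewrite /tilt.
under eq_bigr do rewrite !ffunE.
under [X in _ + X]eq_bigr do rewrite !ffunE.
by rewrite !big_split /= -!scaler_sumr scalerDr addrACA.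
Qed.

HB.instance Definition _ := GRing.isLinear.Build K (rmap K P) K^o *:%R tilt tilt_linear.

Variable A : set (mindex P).
Hypotheses (Ag : forall L, A L -> (g <= mdeg L)%N) (Az : A (indic z *+ g)).

Definition polyhedron : set (rmap K P) :=
  [set a + b | a in convex_hull [set toreal K L | L in A]
             & b in [set b : rmap K P | forall x, 0 <= b x]].

Notation S := polyhedron.
Notation p := (toreal K (indic z *+ g)).

Lemma axis_pointE x : p x = (if x == z then g%:R else 0).
Proof. by rewrite ffunE indicE; case: eqP. Qed.

Lemma polyhedron_bound a : S a -> (forall x, 0 <= a x) /\ g%:R <= \sum_x a x.
Proof.
pose H : set (rmap K P) := [set a | (forall x, 0 <= a x) /\ g%:R <= \sum_x a x].
have cH : @convex_set K (rmap K P) H.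
  move=> a1 a2 l; rewrite !inE => -[a1_0 a1g] [a2_0 a2g].
  have l0 : 0 <= l%:num :> K by [].
  have l1 : 0 <= 1 - l%:num :> K by rewrite subr_ge0.
  have E x : (conv l (a1 : convex_lmodType _) a2 : rmap K P) x = l%:num * a1 x + (1 - l%:num) * a2 x.
    by rewrite [LHS]ffunE !ffunE.
  split=> [x|]; first by rewrite E addr_ge0 ?mulr_ge0.
  under eq_bigr do rewrite E.
  rewrite big_split /= -!mulr_sumr; nra.
move=> [b hb [c c0 <-]].
have [b0 bg] : H b.
  apply: smallest_sub hb => // _ [L AL <-]; split=> [x|]; first by rewrite ffunE ler0n.
  under eq_bigr do rewrite ffunE.
  by rewrite -natr_sum ler_nat; apply: Ag.
split=> [x|]; first by rewrite ffunE addr_ge0.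
under eq_bigr do rewrite ffunE.
by rewrite big_split /= (le_trans bg) // lerDl sumr_ge0.
Qed.

Lemma polyhedronD a b : S a -> (forall x, 0 <= b x) -> S (a + b).
Proof.
move=> [a1 ha [c c0 <-]] b0; exists a1 => //; exists (c + b); last by rewrite addrA.
by move=> x; rewrite ffunE addr_ge0.
Qed.

Lemma polyhedron_axis : S p.
Proof.
exists p; first by apply: sub_gen_smallest; exists (indic z *+ g).
by exists 0; [move=> x; rewrite ffunE|rewrite addr0].
Qed.

Lemma polyhedron_weierstrass : weierstrass_type z S.
Proof.
exists p; first exact: polyhedron_axis.
by move=> x /negbTE xz b /polyhedron_bound[b0 _]; rewrite axis_pointE xz.
Qed.

Lemma tilt_axis : tilt p = g%:R.
Proof.
rewrite /tilt (bigD1 z) //= axis_pointE eqxx !big1 ?addr0 // => x /negbTE xz.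
by rewrite axis_pointE xz.
Qed.

Lemma axis_vertex : vertex S p.
Proof.
split; first by exists p.
exists tilt; apply/seteqP; split=> a /=.
  move=> ->; split; first exact: polyhedron_axis.
  move=> b /polyhedron_bound[b0 bg]; rewrite tilt_axis /tilt.
  by rewrite (le_trans bg) // lerDl sumr_ge0.
move=> [/polyhedron_bound[a0 ag] /(_ p polyhedron_axis)]; rewrite tilt_axis /tilt => le.
have s0 : 0 <= \sum_(x | x != z) a x by apply: sumr_ge0.
have /eqP : \sum_(x | x != z) a x = 0 by apply/eqP; rewrite eq_le s0 andbT; lra.
rewrite psumr_eq0 => // /allP az.
have {}az x : x != z -> a x = 0.
  by move=> xz; have := az x (mem_index_enum _); rewrite xz => /eqP.
apply/ffunP => x; rewrite axis_pointE; case: eqVneq => [->|/az//].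
move: le ag; rewrite (bigD1 z) //= !big1 ?addr0 // => le ag.
by apply/eqP; rewrite eq_le le ag.
Qed.

(** A vertex [b] at height at least [g] is [p + c] with [c] non-negative. The
    linear form [w] that exposes [b] is non-negative on [c], because [b + c] is
    in the polyhedron; so [w p <= w b], and [p] is the exposed vertex. *)
Lemma vertex_axis b : vertex S b -> g%:R <= b z -> b = p.
Proof.
move=> [_ [w wE]] bz.
have [Sb wb] : S b /\ forall a, S a -> w b <= w a.
  by have : [set b] b by []; rewrite wE.
have [b0 _] := polyhedron_bound Sb.
have c0 x : 0 <= (b - p) x.
  by rewrite ffunE [X in _ + X]ffunE axis_pointE; case: eqVneq => [->|_]; rewrite ?subr_ge0 // subr0.
have := wb _ (polyhedronD Sb c0); rewrite linearD lerDl => wc.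
have wp : w p <= w b by rewrite -(subrK p b) linearD lerDr.
suff : [set b] p by [].
rewrite wE; split; first exact: polyhedron_axis.
by move=> a /wb; apply: le_trans.
Qed.

Lemma polyhedron_top : [set a | top_vertex z S a] = [set p].
Proof.
apply/seteqP; split=> a /=.
  move=> [va top]; apply: vertex_axis => //.
  by have := top _ axis_vertex; rewrite axis_pointE eqxx.
move=> ->; split; first exact: axis_vertex.
move=> b vb; rewrite leNgt; apply/negP => lt.
have bp : b = p by apply: vertex_axis => //; move/ltW: lt; rewrite axis_pointE eqxx.
by rewrite bp ltxx in lt.
Qed.

End Polyhedra.

(** * Main factors *)

Section MainFactors.
Variables (k : fieldType) (R : comUnitAlgType k).
Local Notation M := (maxideal R).
Local Notation "'M^' n" := (ideal_pow (maxideal R) n) (at level 8, n at level 2, format "'M^' n").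

(** Each proper factorization lowers the order of the factors, since a
    non-unit has order at least one; so the factorization process stops. *)
Lemma irreducible_factorization n (x : R) : ~ M^n x ->
  exists u (s : seq R), [/\ u \is a GRing.unit, forall w, w \in s -> irreducible_elt w &
    x = u * \prod_(w <- s) w].
Proof.
elim: n x => [|n IH] x xn; first by case: xn; apply: ipow0.
have [xu|xu] := boolP (x \is a GRing.unit).
  by exists x, [::]; rewrite big_nil mulr1.
have [xi|xi] := pselect (irreducible_elt x).
  exists 1, [:: x]; rewrite unitr1 big_seq1 mul1r; split=> // w.
  by rewrite inE => /eqP->.
have [a [b [E au bu]]] : exists a b, [/\ x = a * b, a \isn't a GRing.unit & b \isn't a GRing.unit].
  apply: contrapT => H; apply: xi; split=> // a b E.
  have [au|au] := boolP (a \is a GRing.unit); first by left.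
  have [bu|bu] := boolP (b \is a GRing.unit); first by right.
  by case: H; exists a, b.
have [|u [s [uu si Ea]]] := IH a.
  by move=> an; apply: xn; rewrite E mulrC -add1n; apply: ipow_mul => //; apply: ipow1.
have [|v [t [vu ti Eb]]] := IH b.
  by move=> bn; apply: xn; rewrite E -add1n; apply: ipow_mul => //; apply: ipow1.
exists (u * v), (s ++ t); split; first by rewrite unitrM uu vu.
  by move=> w; rewrite mem_cat => /orP[/si|/ti].
by rewrite E Ea Eb big_cat mulrACA.
Qed.

Variables (Q : {fset R}) (z : Q).

Lemma main_factor_ex n (x : R) : ~ M^n x -> exists y, main_factor z x y.
Proof.
move=> /irreducible_factorization[u [s [uu si ->]]].
exists (1 * \prod_(w <- [fset w in s]%fset | `[< in_Xi z w >]) w ^+ count_mem w s).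
exists u, 1, [fset w in s]%fset, (fun w => count_mem w s); split=> //.
- by rewrite unitr1.
- move=> w; rewrite in_fset /= => ws; split; first exact: si.
  by rewrite -has_count has_pred1.
congr (_ * _); rewrite -(prodr_undup_exp_count s xpredT id).
apply: perm_big; apply: uniq_perm; rewrite ?undup_uniq ?fset_uniq // => w.
by rewrite mem_undup in_fset.
Qed.

Lemma main_factor_dvd (x y : R) : main_factor z x y -> exists r, x = y * r.
Proof.
move=> [u [v [W [a [[uu vu] _ -> ->]]]]].
exists (v^-1 * u * \prod_(w <- W | ~~ `[< in_Xi z w >]) w ^+ a w).
rewrite (bigID (fun w => `[< in_Xi z w >])) /=.
set p := \prod_(_ <- _ | _) _; set q := \prod_(_ <- _ | _) _.
rewrite -[u in LHS](mulKr vu); ring.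
Qed.

Variable K : realType.
Hypothesis kinf : forall p : {poly k}, p != 0 -> exists t, p.[t] != 0.
Hypotheses (nR : noetherian R) (lR : local_ring R) (kR : residue_field_is R).
Hypothesis parQ : param_system Q.

(** The hypotheses say that [x] has order [g] and that [z ^ g] occurs in its
    leading form. *)
Lemma newton_axis (x : R) g : M^g x -> ~ idealD (line z (axis z)) M^g.+1 x ->
  weierstrass_type z (newton K Q x) /\
  [set a | top_vertex z (newton K Q x) a] = [set toreal K (indic z *+ g)].
Proof.
move=> xg xJ; set A := [set L : mindex Q | expansion Q x L != 0].
have Ag L : A L -> (g <= mdeg L)%N.
  apply: contraNT; rewrite -ltnNge => Lg.
  by apply/eqP; apply: (expansion_coef0 kinf nR lR kR parQ z xg).
have Az : A (indic z *+ g) by apply: (expansion_axis kinf nR lR kR parQ).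
by split; [apply: polyhedron_weierstrass Ag Az|apply: polyhedron_top Ag Az].
Qed.

(** Every main factor divides [x], so its leading form contains a pure power of
    [z], whose exponent is the order of the main factor. *)
Lemma Inv_le_order (x : R) h : M^h x -> ~ idealD (line z (axis z)) M^h.+1 x ->
  (exists h', is_Inv K z x h') /\ (forall h', is_Inv K z x h' -> (h' <= h)%N).
Proof.
move=> xh xJ.
have az : axis z z = 1 by rewrite /axis eqxx.
have xM : ~ M^h.+1 x by move=> xh1; apply: xJ; apply: idealDr => //; apply: line_isideal.
have fac y : main_factor z x y -> exists2 g, (g <= h)%N &
    weierstrass_type z (newton K Q y) /\
    [set a | top_vertex z (newton K Q y) a] = [set toreal K (indic z *+ g)].
  move=> /main_factor_dvd[r xE]; rewrite xE in xh xJ.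
  have [g gh [yg yJ]] := factor_line kinf nR lR kR parQ az xh xJ.
  by exists g => //; apply: newton_axis.
split.
  have [y xy] := main_factor_ex xM; have [g gh [wt tv]] := fac y xy.
  by exists g, y.
move=> h' [y [xy _]]; have [g gh [_ ->]] := fac y xy => E.
have : [set toreal K (indic z *+ h')] (toreal K (indic z *+ g)) by rewrite -E.
move=> /(congr1 (fun f : rmap K Q => f z)); rewrite !axis_pointE eqxx => /eqP.
by rewrite eqr_nat => /eqP <-.
Qed.

End MainFactors.

(** * Shearing the parameters *)

Local Open Scope fset_scope.
Local Open Scope ring_scope.

Section Shear.
Variables (k : fieldType) (R : comUnitAlgType k).
Local Notation M := (maxideal R).
Local Notation "'M^' n" := (ideal_pow (maxideal R) n) (at level 8, n at level 2, format "'M^' n").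
Hypotheses (nR : noetherian R) (lR : local_ring R) (kR : residue_field_is R).
Variables (P : {fset R}) (z : P) (alpha : (P `\ fsval z) -> k).
Hypothesis parP : param_system P.

Definition shear := fsval z |`
  [fset fsval x - alpha x *: fsval z | x : P `\ fsval z].

(** The sheared parameters generate [M], so there cannot be fewer of them than
    the dimension; in particular no two of them coincide. *)
Lemma shear_param : param_system shear.
Proof.
have Mi := max_isideal lR; have [PM [[p pc] pmax] MP] := parP.
have inM x : x \in P -> [set` M] x by exact: PM.
have xP (x : P `\ fsval z) : fsval x \in P by have := fsvalP x; rewrite in_fsetD1 => /andP[].
have zS : fsval z \in shear by rewrite !inE eqxx.
have shM x : x \in shear -> [set` M] x.
  rewrite !inE => /orP[/eqP->|/imfsetP[/= y _ ->]]; first exact/inM/fsvalP.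
  exact: (isideal_sub Mi (inM _ (xP y)) (isideal_scale _ Mi (inM _ (fsvalP z)))).
have Mshear x : x \in M <-> genideal [set` shear] x.
  split=> [/MP|]; last first.
    by move=> H; suff : [set` M] x by []; apply: genideal_sub H => // y; apply: shM.
  apply: genideal_sub => // y yP.
  have [->|yz] := eqVneq y (fsval z); first by apply: genideal_gen.
  have yD : y \in P `\ fsval z by rewrite in_fsetD1 yz.
  rewrite -(subrK (alpha [` yD] *: fsval z) y); apply: isideal_add => //.
    by apply: genideal_gen; rewrite /= !inE; apply/orP; right; apply/imfsetP; exists [` yD].
  by apply: isideal_scale => //; apply: genideal_gen.
split=> //.
suff -> : #|` shear| = #|` P| by split => //; exists p.
apply/eqP; rewrite eqn_leq; apply/andP; split.
  rewrite cardfsU1 [X in (_ <= X)%N](cardfsD1 (fsval z)) fsvalP.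
  apply: leq_add; first exact: leq_b1.
  apply: (leq_trans (leq_imfset_card _ _ _)).
  by rewrite -(card_uniqP (enum_finmem_uniq _)) cardfE max_card.
have := @prime_chain_bound _ _ nR lR kR shear 1 _ p shM _ pc; apply.
by move=> x /(ipow1_sub Mi) xM; apply/Mshear.
Qed.

(** The axis of the sheared system is the line of direction [aP] of the
    original one. *)
Lemma shear_axis (zb : shear) (aP : P -> k) : fsval zb = fsval z -> aP z = 1 ->
  (forall (x : P `\ fsval z) (y : P), fsval x = fsval y -> alpha x = aP y) ->
  (line zb (axis zb) `<=` line z aP)%classic.
Proof.
move=> zbz aPz aPE; apply: genideal_sub; first exact: line_isideal.
move=> t /mapP[x]; rewrite mem_enum inE => xzb ->.
have xz : fsval x != fsval z by rewrite -zbz; apply: contraNneq xzb => /val_inj ->.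
have := fsvalP x; rewrite /axis (negbTE xzb) scale0r subr0.
rewrite !inE (negbTE xz) /= => /imfsetP[/= y _ ->].
have yP : fsval y \in P by have := fsvalP y; rewrite in_fsetD1 => /andP[].
by rewrite (aPE y [` yP]) //; exact: (line_mem aPz [` yP]).
Qed.

End Shear.

Theorem lemma4p5 (K : realType) (k : closedFieldType) (R : comUnitAlgType k)
    (d : nat) (P : {fset R}) (z : P) (phi : R) (h : nat) :
  regular_local_ring R -> residue_field_is R -> localization_of_fg R ->
  krull_dim R d -> (1 <= d)%N ->
  param_system P ->
  phi != 0 ->
  ideal_pow (maxideal R) h phi -> ~ ideal_pow (maxideal R) h.+1 phi ->
  exists alpha : (P `\ fsval z) -> k,
    let Pbar := fsval z |`
      [fset fsval x - alpha x *: fsval z | x : P `\ fsval z] in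
    param_system Pbar /\
    exists zbar : Pbar,
      [/\ fsval zbar = fsval z,
          weierstrass_type zbar (newton K Pbar phi),
          [set a | top_vertex zbar (newton K Pbar phi) a] =
            [set toreal K (indic zbar *+ h)],
          (exists h', is_Inv K zbar phi h') &
          (forall h', is_Inv K zbar phi h' -> (h' <= h)%N)].
Proof.
move=> [nR lR _] kR _ _ _ parP _ phih phih1.
have kinf (p : {poly k}) : p != 0 -> exists t, p.[t] != 0.
  by move=> /closed_nonrootP[t]; rewrite rootE; exists t.
have [aP aPz phiJ] := generic_line kinf nR lR kR parP z phih phih1.
pose alpha (x : P `\ fsval z) := aP (fincl (fsubD1set P (fsval z)) x).
have aE (x : P `\ fsval z) (y : P) : fsval x = fsval y -> alpha x = aP y.
  by move=> xy; rewrite /alpha; congr aP; apply: val_inj.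
exists alpha; rewrite /= -/(shear alpha).
have parS := shear_param nR lR kR alpha parP.
split=> //; have zS : fsval z \in shear alpha by rewrite !inE eqxx.
exists [` zS].
have phiS : ~ idealD (line [` zS] (axis [` zS])) (ideal_pow (maxideal R) h.+1) phi.
  apply: contra_not phiJ; apply: idealD_sub.
  - by apply: idealD_isideal => //; apply: line_isideal.
  - by move=> x /(shear_axis (zb := [` zS]) erefl aPz aE) Jx; apply: idealDl.
  - by move=> x xM; apply: idealDr => //; apply: line_isideal.
have [wt tv] := newton_axis K kinf nR lR kR parS phih phiS.
have [Iex Ile] := Inv_le_order K kinf nR lR kR parS phih phiS.
by split.
Qed.
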